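(* Let $T>0$ and $w>0$, and let the intertemporal aggregator $f:[0,T]\times\mathbb{R}_+\times\mathbb{R}\to\mathbb{R}$ satisfy the assumptions (a1)–(a3) listed in the context. A consumption plan $C^*\in\mathcal{X}$ solves the utility maximization problem $$\sup_{C\in\mathcal{A}(w)}U_0^C$$ if and only if the following conditions hold for some finite Lagrange multiplier $M>0$: (i) $\int_0^T\psi_t\,dC^*_t=w$; (ii) $\nabla V(C^* )(t)\le M\psi_t$ for any $t\in[0,T]$; (iii) $\int_0^T\bigl(\nabla V(C^* )(t)-M\psi_t\bigr)\,dC^*_t=0$.
   Context: Notation: $\mathbb{R}_+=[0,\infty)$, $\mathbb{R}_{++}=(0,\infty)$. $\mathcal{X}$ is the set of nondecreasing, right-continuous functions $C:[0,T]\to\mathbb{R}_+$, with the convention $C_{0-}:=0$; each $C\in\mathcal{X}$ is identified with the finite measure $dC$ on $[0,T]$ of which it is the distribution function (so $C_0>0$ is a point mass at $0$). Integrals with respect to $dC$ are over closed intervals. Price: $\psi:[0,T]\to\mathbb{R}_{++}$ is continuous, and $\mathcal{A}(w)=\{C\in\mathcal{X}:\int_0^T\psi_t\,dC_t\le w\}$ is the budget set. Level of satisfaction: $Y^C_t=\eta_t+\int_0^t\theta_{t,s}\,dC_s$, where $\eta:[0,T]\to\mathbb{R}_+$ and $\theta:[0,T]^2\to\mathbb{R}_+$ are continuous. Recursive utility: for $C\in\mathcal{X}$, $U^C$ is the unique solution of $U_t^C=\int_t^T f(s,Y_s^C,U_s^C)\,ds$, $t\in[0,T]$. Utility gradient: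 for $C\in\mathcal{X}$ and $t\in[0,T]$, $$\nabla V(C)(t)=\int_t^T\exp\left(\int_0^s\partial_u f(v,Y_v^C,U_v^C)\,dv\right)\partial_y f(s,Y_s^C,U_s^C)\,\theta_{s,t}\,ds,$$ where $\partial_y f,\partial_u f$ are the partial derivatives of $f(s,y,u)$ in $y$ and $u$. Assumptions on $f$ ($f$ is Borel measurable in $s$): (a1) for each $s\in[0,T]$, $f(s,\cdot,\cdot)$ is strictly concave and continuously differentiable, and for all $s\in[0,T]$, $u\in\mathbb{R}$, $f(s,\cdot,u)$ is strictly increasing; (a2) there is a constant $K>0$ such that $|f(s,y,u)-f(s,y,u')|\le K|u-u'|$ for all $(s,y)\in[0,T]\times\mathbb{R}_+$ and $u,u'\in\mathbb{R}$; (a3) there are constants $\alpha\in(0,1)$ and $K>0$ such that $|f(s,y,0)|\le K(1+|y|^\alpha)$ for all $s\in[0,T]$, $y\in\mathbb{R}_+$.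
   Formalization: The formal theorem also assumes θ_{t,s} > 0 for some 0 ≤ s ≤ t ≤ T; if θ vanishes for all s ≤ t, utility does not depend on the plan, so C* = 0 is optimal although (i) fails and no multiplier M > 0 exists. *)

(* Defs.v *)
From HB Require Import structures.
From mathcomp Require Import all_boot all_order all_algebra.
From mathcomp Require Import all_classical all_reals all_analysis.
Set Implicit Arguments.
Unset Strict Implicit.
Unset Printing Implicit Defensive.
Import Order.TTheory GRing.Theory Num.Theory.
Import numFieldNormedType.Exports.
Local Open Scope classical_set_scope.
Local Open Scope ring_scope.

(* Functions of time, such as psi, eta, theta, f and U, are total functions on
   R of which only the values at times in [0, T] are used; likewise f s y u is
   only used for y >= 0. *)

(* A consumption plan on [0, T] is represented by its canonical extension to R:
   0 before time 0 (the convention C_{0-} = 0) and constant after T.  With this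
   extension lebesgue_stieltjes_measure C is the measure dC, including the
   point mass C 0 at 0; nonnegativity of C follows from monotonicity. *)
Definition consumption_plan {R : realType} (T : R) : set (cumulative R R) :=
  [set C | (forall t, t < 0 -> C t = 0) /\ (forall t, T <= t -> C t = C T)].

Definition budget_set {R : realType} (T w : R) (psi : R -> R) :
    set (cumulative R R) :=
  [set C | consumption_plan T C /\
    (\int[lebesgue_stieltjes_measure C]_(t in `[0%R, T]) (psi t)%:E <= w%:E)%E].

Definition satisfaction {R : realType} (eta : R -> R) (theta : R -> R -> R)
    (C : cumulative R R) (t : R) : R :=
  eta t + \int[lebesgue_stieltjes_measure C]_(s in `[0, t]) theta t s.

(* Integrability is required because the integral of a non-integrable function
   has a default value. *)
Definition is_recursive_utility {R : realType} (T : R) (f : R -> R -> R -> R)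
    (Y U : R -> R) : Prop :=
  (@lebesgue_measure R).-integrable `[0, T] (fun s => (f s (Y s) (U s))%:E) /\
  forall t, t \in `[0, T] ->
    U t = \int[@lebesgue_measure R]_(s in `[t, T]) f s (Y s) (U s).

(* The solution is unique on [0, T]; its values elsewhere are immaterial. *)
Definition recursive_utility {R : realType} (T : R) (f : R -> R -> R -> R)
    (eta : R -> R) (theta : R -> R -> R) (C : cumulative R R) : R -> R :=
  xget (fun=> 0) (is_recursive_utility T f (satisfaction eta theta C)).

(* The variable y ranges over [0, +oo[, so the partial derivative in y is the
   derivative relative to that set: the usual one at y > 0, the right
   derivative at y = 0. *)
Definition quotient_y {R : realType} (f : R -> R -> R -> R) (s y u : R) :
    R -> R :=
  fun z => (f s z u - f s y u) / (z - y).

Definition partial_y {R : realType} (f : R -> R -> R -> R) (s y u : R) : R :=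
  lim (quotient_y f s y u z @[z --> within [set z | 0 <= z] y^']).

Definition partial_u {R : realType} (f : R -> R -> R -> R) (s y u : R) : R :=
  derive1 (f s y) u.

(* The outer integral is extended-real valued since its nonnegative integrand
   need not be integrable; the inner one has an integrand bounded by K. *)
Definition utility_gradient {R : realType} (T : R) (f : R -> R -> R -> R)
    (eta : R -> R) (theta : R -> R -> R) (C : cumulative R R) (t : R) :
    \bar R :=
  let Y := satisfaction eta theta C in
  let U := recursive_utility T f eta theta C in
  (\int[@lebesgue_measure R]_(s in `[t, T])
     (expR (\int[@lebesgue_measure R]_(v in `[0%R, s])
              partial_u f v (Y v) (U v))%R
      * partial_y f s (Y s) (U s) * theta s t)%:E)%E.

Definition solves_utility_maximization {R : realType} (T w : R)
    (psi eta : R -> R) (theta : R -> R -> R) (f : R -> R -> R -> R)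
    (C : cumulative R R) : Prop :=
  budget_set T w psi C /\
  forall D, budget_set T w psi D ->
    recursive_utility T f eta theta D 0 <= recursive_utility T f eta theta C 0.

Definition strictly_concave_in_yu {R : realType} (f : R -> R -> R -> R)
    (s : R) : Prop :=
  forall y1 u1 y2 u2 l : R, 0 <= y1 -> 0 <= y2 -> (y1, u1) <> (y2, u2) ->
    0 < l < 1 ->
    l * f s y1 u1 + (1 - l) * f s y2 u2
      < f s (l * y1 + (1 - l) * y2) (l * u1 + (1 - l) * u2).

Definition continuously_differentiable_in_yu {R : realType}
    (f : R -> R -> R -> R) (s : R) : Prop :=
  [/\ forall y u, 0 <= y ->
        cvg (quotient_y f s y u z @[z --> within [set z | 0 <= z] y^']) /\
        derivable (f s y) u 1,
      {within [set p : R * R | 0 <= p.1],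
        continuous (fun p : R * R => partial_y f s p.1 p.2)} &
      {within [set p : R * R | 0 <= p.1],
        continuous (fun p : R * R => partial_u f s p.1 p.2)}].

Record aggregator_assumptions {R : realType} (T : R)
    (f : R -> R -> R -> R) : Prop := {
  aggregator_measurable : forall y u, 0 <= y ->
    measurable_fun `[0, T] (fun s => f s y u) ;
  aggregator_concave : forall s, s \in `[0, T] -> strictly_concave_in_yu f s ;
  aggregator_C1 : forall s, s \in `[0, T] ->
    continuously_differentiable_in_yu f s ;
  aggregator_increasing : forall s u y y', s \in `[0, T] ->
    0 <= y -> y < y' -> f s y u < f s y' u ;
  aggregator_lipschitz : exists K : R, 0 < K /\
    forall s y u u', s \in `[0, T] -> 0 <= y ->
      `|f s y u - f s y u'| <= K * `|u - u'| ;
  aggregator_growth : exists alpha K : R, [/\ 0 < alpha < 1, 0 < K &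
    forall s y, s \in `[0, T] -> 0 <= y ->
      `|f s y 0| <= K * (1 + `|y| `^ alpha)]
}.

(* Main.v *)
From HB Require Import structures.
From mathcomp Require Import all_boot all_order all_algebra.
From mathcomp Require Import ring lra.
From mathcomp Require Import all_classical all_reals all_analysis.
From mathcomp Require Import measurable_realfun.
Require Import Defs.
Set Implicit Arguments.
Unset Strict Implicit.
Unset Printing Implicit Defensive.
Import Order.TTheory GRing.Theory Num.Theory.
Import numFieldNormedType.Exports.
Local Open Scope classical_set_scope.
Local Open Scope ring_scope.

(** Write [p_C s] for the discount factor [exp (int_0^s d_u f)] times [d_y f]
    along the plan [C], so that the gradient at time [t] is the integral of
    [p_C s * theta s t] over [s] in [[t, T]].  By Tonelli's theorem
    ([integral_later_effect]) it is paired with plans by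
      int grad V(C) dD = int_0^T p_C s * (Y^D_s - eta_s) ds,
    where both sides may be infinite.

    The utility is concave in the plan and lies below its tangent
    ([utility_variation]):
      U^D_0 - U^C_0 <= int grad V(C) dD - int grad V(C) dC.
    Indeed [h = U^D - U^C] solves a backward equation whose integrand is at most
    [d_u f * h + d_y f * (Y^D - Y^C)], by joint concavity of [f], and variation
    of constants turns this bound into one for [h 0].  If (i)-(iii) hold for
    [C], the right-hand side is at most [M * int psi dD - M * w <= 0] for every
    affordable [D]: the conditions are sufficient.

    Conversely let [C] be optimal, fix a time [t], and move a share [e] of the
    budget to a mass at [t]; let [C_e] be the resulting plan.  The gradient at [C]
    itself could be infinite, since [d_y f] may fail to be integrable in time
    where the satisfaction vanishes, so the tangent is taken at [C_e] and
    evaluated at [C].  Optimality then says that, against [p_(C_e)], the plan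
    spending the budget on the mass at [t] weighs at most as much as [C].  As
    [e] tends to 0, Fatou's lemma applies on the side of the mass; on the side
    of [C] the integrands are bounded, because concavity bounds [y * d_y f(y)] by
    [f(y) - f(0)] ([marginal_utility_bounded]).  In the limit
    ([first_order_condition])
      w / psi t * grad V(C)(t) <= L := int grad V(C) dC < +oo.
    So (ii) holds with [M = L / w]; integrating (ii) against [dC] gives
    [L <= M * int psi dC <= M * w = L], whence (i) and (iii).  Finally [M > 0]
    because [d_y f > 0] and [theta] is positive on a set of times of positive
    measure after some time [t] ([later_effect_gt0]).

    The utilities exist by Picard iteration ([backward_equation_solvable]) and
    depend continuously on the satisfaction by Gronwall's inequality
    ([backward_stability]).  In time, [f] is merely measurable, so calculus along
    the solutions is done for primitives of bounded measurable functions, by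
    comparing increments up to second order
    ([quadratic_increments_Rintegral]). *)

(** * Integrals of bounded functions *)

Lemma cvg_within_forall (Y : Type) (F : set_system Y) (X : topologicalType)
    (A : set X) (x : X) (u : Y -> X) : Filter F ->
  (forall y, A (u y)) -> u @ F --> x -> u @ F --> within A (nbhs x).
Proof.
move=> FF Au ux B /= /ux uB.
have {}uB : \forall y \near F, A (u y) -> B (u y) := uB.
by apply: filterS uB => y; exact.
Qed.

Lemma cvg_dist_le (R : realType) (f e : nat -> R) a :
  (forall n, `|f n - a| <= e n) -> e n @[n --> \oo] --> 0 ->
  f n @[n --> \oo] --> a.
Proof.
move=> fe e0; apply/subr_cvg0; apply/norm_cvg0P.
by apply: squeeze_cvgr (cvg_cst 0) e0; apply: nearW => n; rewrite normr_ge0 fe.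
Qed.

Section integrals_of_bounded_functions.
Context d (X : measurableType d) (R : realType).
Variable m : {measure set X -> \bar R}.
Implicit Types (D : set X) (f : X -> R).

Lemma bounded_integrable D f (B : R) : measurable D -> (m D < +oo)%E ->
  measurable_fun D f -> (forall x, D x -> `|f x| <= B) ->
  m.-integrable D (EFin \o f).
Proof.
move=> mD mDy mf fB; apply: measurable_bounded_integrable => //.
exists B; split; first exact: num_real.
by move=> M BM x Dx /=; exact: le_trans (fB x Dx) (ltW BM).
Qed.

Lemma norm_Rintegral_le D f (B : R) : measurable D -> (m D < +oo)%E ->
  measurable_fun D f -> (forall x, D x -> `|f x| <= B) ->
  `|\int[m]_(x in D) f x| <= B * fine (m D).
Proof.
move=> mD mDy mf fB; have intf := bounded_integrable mD mDy mf fB.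
apply: le_trans (le_normr_Rintegral mD intf) _.
rewrite -(Rintegral_cst m mD B); apply: le_Rintegral => //.
  by apply: integrable_norm.
exact: (bounded_integrable (B := `|B|)).
Qed.

Lemma integrable_mulr D f (r : R) : measurable D ->
  m.-integrable D (EFin \o f) -> m.-integrable D (EFin \o (fun x => f x * r)).
Proof.
move=> mD /(integrableZr mD r); exact: eq_integrable.
Qed.

Lemma integrable_subr D f g : measurable D ->
  m.-integrable D (EFin \o f) -> m.-integrable D (EFin \o g) ->
  m.-integrable D (EFin \o (fun x => f x - g x)).
Proof.
move=> mD intf /(integrableB mD intf); exact: eq_integrable.
Qed.

Lemma Rintegral_mul_subr D f g (c : R) : measurable D ->
  m.-integrable D (EFin \o f) -> m.-integrable D (EFin \o (fun x => f x * g x)) ->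
  \int[m]_(x in D) (f x * g x) =
  c * \int[m]_(x in D) f x + \int[m]_(x in D) (f x * (g x - c)).
Proof.
move=> mD intf intfg; under [X in _ = _ + X]eq_Rintegral do rewrite mulrBr.
have intfc := integrable_mulr c mD intf.
by rewrite (RintegralB mD intfg intfc) (RintegralZr c mD intf); ring.
Qed.

Lemma Rintegral_subr_lin D f g h (c e : R) : measurable D ->
  m.-integrable D (EFin \o f) -> m.-integrable D (EFin \o g) ->
  m.-integrable D (EFin \o h) ->
  \int[m]_(x in D) f x = c * \int[m]_(x in D) g x + e * \int[m]_(x in D) h x
    + \int[m]_(x in D) (f x - g x * c - h x * e).
Proof.
move=> mD intf intg inth.
have intgc := integrable_mulr c mD intg; have inthe := integrable_mulr e mD inth.
rewrite (RintegralB mD (integrable_subr mD intf intgc) inthe).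
by rewrite (RintegralB mD intf intgc) !RintegralZr //; ring.
Qed.

Lemma bounded_convergence D (f_ : nat -> X -> R) f (B : R) : measurable D ->
  (m D < +oo)%E -> (forall n, measurable_fun D (f_ n)) ->
  (forall n x, D x -> `|f_ n x| <= B) ->
  (forall x, D x -> f_ n x @[n --> \oo] --> f x) ->
  \int[m]_(x in D) f_ n x @[n --> \oo] --> \int[m]_(x in D) f x.
Proof.
move=> mD mDy mf_ f_B f_f.
have mf : measurable_fun D f by apply: measurable_fun_cvg f_f.
have [|||||intf _ cvgf] := @dominated_convergence _ _ _ m D mD
    (fun n => EFin \o f_ n) (EFin \o f) (cst B%:E).
- by move=> n; apply/measurable_EFinP.
- exact/measurable_EFinP.
- by apply: aeW => x Dx; apply: cvg_EFin; [exact: nearW|exact: f_f].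
- apply: (bounded_integrable (B := `|B|)) => //.
- by apply: aeW => x n Dx; rewrite /= lee_fin f_B.
apply: fine_cvg; rewrite fineK //.
exact: (integrable_fin_num mD intf).
Qed.

(** Fatou's lemma, in the form of a passage to the limit in an upper bound. *)
Lemma integral_lim_le D (f_ : nat -> X -> \bar R) (f : X -> \bar R)
    (v : nat -> \bar R) (l : \bar R) : measurable D ->
  (forall n, measurable_fun D (f_ n)) ->
  (forall n x, D x -> (0 <= f_ n x)%E) ->
  (forall x, D x -> f_ n x @[n --> \oo] --> f x) ->
  (forall n, (\int[m]_(x in D) f_ n x <= v n)%E) -> v n @[n --> \oo] --> l ->
  (\int[m]_(x in D) f x <= l)%E.
Proof.
move=> mD mf_ f_0 f_f f_v vl.
apply: (@le_trans _ _ (\int[m]_(x in D) limn_einf (f_ ^~ x))%E).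
  rewrite le_eqVlt; apply/orP; left; apply/eqP; apply: eq_integral => x.
  by rewrite inE => Dx; rewrite (cvg_limn_einf_sup (f_f x Dx)).
apply: le_trans (fatou m mD mf_ f_0) _; rewrite limn_einf_lim.
rewrite -(cvg_lim _ vl) //; apply: lee_lim; first exact: is_cvg_einfs.
  by apply/cvg_ex; exists l.
apply: nearW => n; apply: le_trans (f_v n); apply: ereal_inf_lbound.
by exists n; first exact: leqnn.
Qed.

End integrals_of_bounded_functions.

Section calculus.
Context {R : realType}.
Notation mu := (@lebesgue_measure R).
Implicit Types (a b s t A B c : R) (f g : R -> R).

Lemma lebesgue_itvcc a b : a <= b -> fine (mu `[a, b]) = b - a.
Proof.
move=> ab; rewrite lebesgue_measure_itv /= lte_fin.
by case: ltP => //= ba; rewrite (@le_anti _ _ a b) ?ab ?ba ?subrr.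
Qed.

Lemma lebesgue_itvcc_lty a b : (mu `[a, b] < +oo)%E.
Proof. by rewrite lebesgue_measure_itv /=; case: ifP => _; rewrite ltry. Qed.

Lemma itvcc_integrable a b f B : measurable_fun `[a, b] f ->
  (forall x, x \in `[a, b] -> `|f x| <= B) ->
  mu.-integrable `[a, b] (EFin \o f).
Proof.
move=> mf fB; apply: (bounded_integrable (B := B)) => //.
exact: lebesgue_itvcc_lty.
Qed.

Lemma norm_Rintegral_itvcc a b f B : a <= b -> measurable_fun `[a, b] f ->
  (forall x, x \in `[a, b] -> `|f x| <= B) ->
  `|\int[mu]_(x in `[a, b]) f x| <= B * (b - a).
Proof.
move=> ab mf fB; rewrite -(lebesgue_itvcc ab).
by apply: norm_Rintegral_le => //; exact: lebesgue_itvcc_lty.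
Qed.

Lemma Rintegral_itvcc_cat a b s f : mu.-integrable `[a, b] (EFin \o f) ->
  s \in `[a, b] ->
  \int[mu]_(x in `[a, b]) f x =
  \int[mu]_(x in `[a, s]) f x + \int[mu]_(x in `[s, b]) f x.
Proof.
move=> intf; rewrite in_itv /= => /andP[as_ sb].
have := @Rintegral_itvB R f (BLeft a) (BRight b) s intf.
rewrite !bnd_simp => /(_ as_ sb); rewrite Rintegral_itv_obnd_cbnd; last first.
  by apply: integrableS intf => //; apply: subset_itv; rewrite bnd_simp.
by move/eqP; rewrite subr_eq addrC => /eqP.
Qed.

Lemma Rintegral_itv11 s f : \int[mu]_(x in `[s, s]) f x = 0.
Proof. by rewrite set_itv1 Rintegral_set1. Qed.

(** A primitive is recognised from its increments, with no derivative taken: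
    cutting [[a, b]] into [n] intervals of equal length leaves a total error of
    at most [c * (b - a) ^+ 2 / n]. *)
Lemma quadratic_increments_Rintegral a b (phi : R -> R) d c : a <= b ->
  mu.-integrable `[a, b] (EFin \o d) ->
  (forall s t, a <= s -> s <= t -> t <= b ->
     `|phi t - phi s - \int[mu]_(r in `[s, t]) d r| <= c * (t - s) ^+ 2) ->
  phi b - phi a = \int[mu]_(r in `[a, b]) d r.
Proof.
move=> ab intd dphi.
set e := phi b - phi a - \int[mu]_(r in `[a, b]) d r.
suff e0 : e = 0 by apply/eqP; rewrite -subr_eq0; apply/eqP.
have c0 : 0 <= c * (b - a) ^+ 2.
  by apply: le_trans (dphi a b _ _ _) => //.
have en n : `|e| <= c * (b - a) ^+ 2 / n.+1%:R.
  pose h := (b - a) / n.+1%:R.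
  have h0 : 0 <= h by rewrite divr_ge0 // subr_ge0.
  pose x (i : nat) := a + i%:R * h.
  have xS i : x i.+1 - x i = h by rewrite /x -natr1; ring.
  have xle i : x i <= x i.+1 by rewrite -subr_ge0 xS.
  have xn : x n.+1 = b.
    by rewrite /x /h mulrC divfK ?pnatr_eq0 // addrC subrK.
  have x0 : x 0%N = a by rewrite /x mul0r addr0.
  have xa i : a <= x i by rewrite /x lerDl mulr_ge0.
  have xb i : (i <= n.+1)%N -> x i <= b.
    by move=> i_n; rewrite -xn /x lerD2l ler_wpM2r // ler_nat.
  have key k : (k <= n.+1)%N ->
      `|phi (x k) - phi a - \int[mu]_(r in `[a, x k]) d r|
        <= k%:R * (c * h ^+ 2).
    elim: k => [_|k IH kn].
      by rewrite x0 Rintegral_itv11 !subrr normr0 mul0r.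
    have -> : \int[mu]_(r in `[a, x k.+1]) d r =
        \int[mu]_(r in `[a, x k]) d r + \int[mu]_(r in `[x k, x k.+1]) d r.
      apply: Rintegral_itvcc_cat; last by rewrite in_itv /= xa xle.
      apply: integrableS intd => //; apply: subset_itv; rewrite bnd_simp //.
      exact: xb.
    have := dphi (x k) (x k.+1) (xa k) (xle k) (xb _ kn); rewrite xS => h1.
    have h2 := IH (ltnW kn); rewrite -natr1 mulrDl mul1r.
    apply: le_trans (lerD h2 h1); apply: le_trans (ler_normD _ _).
    by rewrite le_eqVlt; apply/orP; left; apply/eqP; congr `|_|; ring.
  have := key n.+1 (leqnn _); rewrite xn => /le_trans; apply.
  rewrite le_eqVlt; apply/orP; left; apply/eqP; rewrite /h.
  by field; rewrite addrC natr1 pnatr_eq0.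
apply/eqP; rewrite -normr_eq0; apply/eqP/le_anti; rewrite normr_ge0 andbT.
apply/ler_addgt0Pl => eps eps0; rewrite addr0.
set q := c * (b - a) ^+ 2 in c0 en.
have [N qN] : exists N : nat, q / eps < N.+1%:R.
  exists (Num.bound (q / eps)).
  have /lt_trans -> // := archi_boundP (divr_ge0 c0 (ltW eps0)).
  by rewrite ltr_nat.
apply: le_trans (en N) _; rewrite ler_pdivrMr ?ltr0n //.
by rewrite mulrC -ler_pdivrMr // ltW.
Qed.

Lemma norm_expRB1 (x m : R) : `|x| <= m -> `|expR x - 1| <= `|x| * expR m.
Proof.
move=> xm; have [x0|x0] := leP 0 x.
  have e1 : 1 <= expR x by rewrite -expR0 ler_expR.
  rewrite (ger0_norm x0) in xm *; rewrite ger0_norm ?subr_ge0 //.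
  have : expR x - 1 <= x * expR x.
    have := expR_ge1Dx (- x); rewrite expRN => /(ler_wpM2r (expR_ge0 x)).
    by rewrite mulVf ?gt_eqF ?expR_gt0 //; lra.
  by move/le_trans; apply; rewrite ler_wpM2l // ler_expR.
have e1 : expR x <= 1 by rewrite -[leRHS]expR0 ler_expR ltW.
rewrite distrC ger0_norm ?subr_ge0 //.
have := expR_ge1Dx x; rewrite ltr0_norm // in xm * => h.
have : 1 <= expR m by rewrite -expR0 ler_expR; lra.
by nra.
Qed.

Lemma norm_expRB1Bid (x m : R) : `|x| <= m ->
  `|expR x - 1 - x| <= x ^+ 2 * expR m.
Proof.
move=> xm; have h1 := expR_ge1Dx x.
rewrite ger0_norm; last by lra.
have h2 : expR x - 1 - x <= x * (expR x - 1).
  have := expR_ge1Dx (- x); rewrite expRN => /(ler_wpM2r (expR_ge0 x)).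
  by rewrite mulVf ?gt_eqF ?expR_gt0 //; lra.
apply: le_trans h2 _; apply: le_trans (ler_norm _) _.
rewrite normrM -real_normK ?num_real // expr2 -mulrA ler_wpM2l //.
exact: norm_expRB1.
Qed.

Lemma measurable_primitive a b f : a <= b ->
  mu.-integrable `[a, b] (EFin \o f) ->
  measurable_fun `[a, b] (fun t => \int[mu]_(s in `[a, t]) f s).
Proof.
move=> ab intf; apply: subspace_continuous_measurable_fun => //.
exact: parameterized_integral_continuous.
Qed.

Lemma measurable_backward_primitive a b f : a <= b ->
  mu.-integrable `[a, b] (EFin \o f) ->
  measurable_fun `[a, b] (fun t => \int[mu]_(s in `[t, b]) f s).
Proof.
move=> ab intf; apply: (eq_measurable_fun
    (fun t => \int[mu]_(s in `[a, b]) f s - \int[mu]_(s in `[a, t]) f s)).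
  move=> t; rewrite inE => tab.
  by rewrite (Rintegral_itvcc_cat intf tab) addrC addKr.
exact: (measurable_funB (measurable_cst _) (measurable_primitive ab intf)).
Qed.

Lemma measurable_expR_primitive a b f : a <= b ->
  mu.-integrable `[a, b] (EFin \o f) ->
  measurable_fun `[a, b] (fun t => expR (\int[mu]_(s in `[a, t]) f s)).
Proof.
by move=> ab intf; apply: measurableT_comp => //; exact: measurable_primitive.
Qed.

Lemma subitvcc a b s t : a <= s -> t <= b -> `[s, t] `<=` `[a, b].
Proof. by move=> as_ tb; apply: subset_itv; rewrite bnd_simp. Qed.

Lemma measurable_fun_subitv a b s t f : a <= s -> t <= b ->
  measurable_fun `[a, b] f -> measurable_fun `[s, t] f.
Proof. by move=> as_ tb; apply: measurable_funS => //; exact: subitvcc. Qed.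

Lemma integrable_subitv a b s t f : a <= s -> t <= b ->
  mu.-integrable `[a, b] (EFin \o f) -> mu.-integrable `[s, t] (EFin \o f).
Proof. by move=> as_ tb; apply: integrableS => //; exact: subitvcc. Qed.

Lemma Rintegral_incr a b f s t : mu.-integrable `[a, b] (EFin \o f) ->
  a <= s -> s <= t -> t <= b ->
  \int[mu]_(r in `[a, t]) f r =
  \int[mu]_(r in `[a, s]) f r + \int[mu]_(r in `[s, t]) f r.
Proof.
move=> intf as_ st tb; apply: Rintegral_itvcc_cat; last by rewrite in_itv /= as_.
exact: integrable_subitv intf.
Qed.

(** The chain rule for the exponential of a primitive of a function that is
    merely bounded and measurable: the increments of both sides agree to second
    order. *)
Lemma expR_Rintegral a b (alpha : R -> R) A : a <= b ->
  measurable_fun `[a, b] alpha ->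
  (forall s, s \in `[a, b] -> `|alpha s| <= A) ->
  let E := fun s => expR (\int[mu]_(v in `[a, s]) alpha v) in
  E b - E a = \int[mu]_(s in `[a, b]) (alpha s * E s).
Proof.
move=> ab malpha alphaA E.
have A0 : 0 <= A.
  by apply: le_trans (alphaA a _) => //; rewrite in_itv /= lexx.
have intalpha := itvcc_integrable malpha alphaA.
pose m := A * (b - a).
have Kle s t : a <= s -> s <= t -> t <= b ->
    `|\int[mu]_(v in `[s, t]) alpha v| <= A * (t - s).
  move=> as_ st tb; apply: norm_Rintegral_itvcc => //.
    exact: measurable_fun_subitv malpha.
  by move=> x xst; apply: alphaA; exact: subitvcc as_ tb _ xst.
have lem s t : a <= s -> t <= b -> A * (t - s) <= m.
  by move=> as_ tb; apply: ler_wpM2l => //; apply: lerB.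
have EM s t : a <= s -> s <= t -> t <= b ->
    E t = E s * expR (\int[mu]_(v in `[s, t]) alpha v).
  by move=> as_ st tb; rewrite /E (Rintegral_incr intalpha as_ st tb) expRD.
have Ele s : a <= s -> s <= b -> E s <= expR m.
  move=> as_ sb; rewrite ler_expR; apply: le_trans (ler_norm _) _.
  by apply: le_trans (Kle _ _ _ _ _) _ => //; exact: lem.
have mE : measurable_fun `[a, b] E.
  exact: measurable_expR_primitive.
have maE : measurable_fun `[a, b] (fun s => alpha s * E s).
  exact: measurable_funM.
have intaE : mu.-integrable `[a, b] (EFin \o (fun s => alpha s * E s)).
  apply: (itvcc_integrable (B := A * expR m)) => // s.
  move=> sab; have := sab; rewrite in_itv /= => /andP[as_ sb].
  rewrite normrM ler_pM //; first exact: alphaA.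
  by rewrite ger0_norm ?expR_ge0 // Ele.
have Er s t r : a <= s -> t <= b -> r \in `[s, t] ->
    `|E r - E s| <= expR m ^+ 2 * A * (t - s).
  move=> as_ tb; rewrite in_itv /= => /andP[sr rt].
  have rb := le_trans rt tb.
  rewrite (EM s r) // -[X in _ - X]mulr1 -mulrBr normrM.
  rewrite ger0_norm ?expR_ge0 // expr2 -!mulrA ler_pM ?expR_ge0 //.
    by apply: Ele => //; exact: le_trans sr rb.
  apply: le_trans (norm_expRB1 (le_trans (Kle _ _ _ _ _) (lem s r _ _))) _ => //.
  rewrite mulrC ler_wpM2l ?expR_ge0 //; apply: le_trans (Kle _ _ _ _ _) _ => //.
  by rewrite ler_wpM2l // lerD2r.
apply: (@quadratic_increments_Rintegral _ _ _ _
  (2 * (expR m ^+ 2 * A ^+ 2))) => //.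
move=> s t as_ st tb; set K := \int[mu]_(v in `[s, t]) alpha v.
have sb := le_trans st tb.
have ints (f : R -> R) : mu.-integrable `[a, b] (EFin \o f) ->
    mu.-integrable `[s, t] (EFin \o f).
  exact: integrable_subitv.
have mst : measurable (`[s, t]%classic : set R) by exact: measurable_itv.
rewrite (Rintegral_mul_subr (m := mu) (E s) mst (ints _ intalpha) (ints _ intaE)).
rewrite (EM s t) // -/K.
rewrite (_ : _ - _ = E s * (expR K - 1 - K)
  - \int[mu]_(r in `[s, t]) (alpha r * (E r - E s))); last by ring.
apply: le_trans (ler_normB _ _) _.
rewrite [leRHS](_ : _ = expR m ^+ 2 * (A ^+ 2 * (t - s) ^+ 2)
  + A * (expR m ^+ 2 * A * (t - s)) * (t - s)); last by ring.
apply: lerD.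
  rewrite normrM ger0_norm ?expR_ge0 //.
  apply: (@le_trans _ _ (expR m * (K ^+ 2 * expR m))).
    rewrite ler_pM ?expR_ge0 //; first exact: Ele.
    apply: norm_expRB1Bid; apply: le_trans (Kle _ _ _ _ _) _ => //.
    exact: lem.
  rewrite (_ : expR m * _ = expR m ^+ 2 * K ^+ 2); last by ring.
  rewrite ler_wpM2l ?sqr_ge0 // -exprMn -real_normK ?num_real //.
  by rewrite lerXn2r ?nnegrE // ?mulr_ge0 ?subr_ge0 // Kle.
apply: norm_Rintegral_itvcc => //.
  apply: (measurable_fun_subitv as_ tb); apply: (measurable_funM malpha).
  exact: (measurable_funB mE (measurable_cst _)).
move=> r rst; rewrite normrM ler_pM //; last exact: Er.
by apply: alphaA; exact: subitvcc as_ tb _ rst.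
Qed.

(** Integration by parts without continuity of the derivatives: the two sides
    have the same increments up to second order. *)
Lemma Rintegral_product_rule a b (u v u' v' : R -> R) A B : a <= b ->
  measurable_fun `[a, b] u' -> (forall s, s \in `[a, b] -> `|u' s| <= A) ->
  measurable_fun `[a, b] v' -> (forall s, s \in `[a, b] -> `|v' s| <= B) ->
  (forall t, t \in `[a, b] -> u t = u a + \int[mu]_(s in `[a, t]) u' s) ->
  (forall t, t \in `[a, b] -> v t = v a + \int[mu]_(s in `[a, t]) v' s) ->
  u b * v b - u a * v a = \int[mu]_(s in `[a, b]) (u' s * v s + u s * v' s).
Proof.
move=> ab mu' u'A mv' v'B uE vE.
have aab : a \in `[a, b] by rewrite in_itv /= lexx.
have A0 : 0 <= A by apply: le_trans (u'A a aab).
have B0 : 0 <= B by apply: le_trans (v'B a aab).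
have intu' := itvcc_integrable mu' u'A.
have intv' := itvcc_integrable mv' v'B.
have mprim (w w' : R -> R) : measurable_fun `[a, b] w' ->
    mu.-integrable `[a, b] (EFin \o w') ->
    (forall t, t \in `[a, b] -> w t = w a + \int[mu]_(s in `[a, t]) w' s) ->
    measurable_fun `[a, b] w.
  move=> mw' intw' wE.
  apply: (eq_measurable_fun (fun t => w a + \int[mu]_(s in `[a, t]) w' s)).
    by move=> t; rewrite inE => tab; rewrite -(wE t).
  exact: (measurable_funD (measurable_cst _) (measurable_primitive ab intw')).
have mu_ := mprim _ _ mu' intu' uE.
have mv_ := mprim _ _ mv' intv' vE.
have incr (w w' : R -> R) W s t :
    measurable_fun `[a, b] w' ->
    (forall s, s \in `[a, b] -> `|w' s| <= W) ->
    mu.-integrable `[a, b] (EFin \o w') ->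
    (forall t, t \in `[a, b] -> w t = w a + \int[mu]_(s in `[a, t]) w' s) ->
    a <= s -> s <= t -> t <= b ->
    w t = w s + \int[mu]_(r in `[s, t]) w' r /\ `|w t - w s| <= W * (t - s).
  move=> mw' w'W intw' wE as_ st tb.
  have wts : w t = w s + \int[mu]_(r in `[s, t]) w' r.
    rewrite wE ?in_itv /= ?tb ?(le_trans as_) //.
    rewrite [w s]wE ?in_itv /= ?as_ ?(le_trans st) //.
    by rewrite (Rintegral_incr intw' as_ st tb) addrA.
  split => //; rewrite wts addrC addKr; apply: norm_Rintegral_itvcc => //.
    exact: measurable_fun_subitv mw'.
  by move=> r rst; apply: w'W; exact: subitvcc as_ tb _ rst.
have bnd (w w' : R -> R) W t :
    measurable_fun `[a, b] w' ->
    (forall s, s \in `[a, b] -> `|w' s| <= W) ->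
    mu.-integrable `[a, b] (EFin \o w') ->
    (forall t, t \in `[a, b] -> w t = w a + \int[mu]_(s in `[a, t]) w' s) ->
    0 <= W -> t \in `[a, b] -> `|w t| <= `|w a| + W * (b - a).
  move=> mw' w'W intw' wE W0; rewrite in_itv /= => /andP[at_ tb].
  have [_ h] := incr _ _ _ _ _ mw' w'W intw' wE (lexx a) at_ tb.
  rewrite -[w t](subrK (w a)) addrC; apply: le_trans (ler_normD _ _) _.
  by rewrite lerD2l (le_trans h) // ler_wpM2l // lerD2r.
pose U := `|u a| + A * (b - a); pose V := `|v a| + B * (b - a).
have uU t : t \in `[a, b] -> `|u t| <= U by exact: bnd mu' u'A intu' uE A0.
have vV t : t \in `[a, b] -> `|v t| <= V by exact: bnd mv' v'B intv' vE B0.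
have md : measurable_fun `[a, b] (fun s => u' s * v s + u s * v' s).
  exact: (measurable_funD (measurable_funM mu' mv_) (measurable_funM mu_ mv')).
have intd : mu.-integrable `[a, b] (EFin \o (fun s => u' s * v s + u s * v' s)).
  apply: (itvcc_integrable (B := A * V + U * B)) => // s sab.
  apply: le_trans (ler_normD _ _) _.
  by rewrite !normrM lerD // ler_pM ?uU ?vV ?u'A ?v'B.
apply: (@quadratic_increments_Rintegral _ _ (fun t => u t * v t) _
  (A * B + (A * B + A * B))) => // s t as_ st tb.
have [uts duts] := incr _ _ _ _ _ mu' u'A intu' uE as_ st tb.
have [vts dvts] := incr _ _ _ _ _ mv' v'B intv' vE as_ st tb.
pose rem r := u' r * (v r - v s) + (u r - u s) * v' r.
have mrem : measurable_fun `[a, b] rem.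
  exact: (measurable_funD
    (measurable_funM mu' (measurable_funB mv_ (measurable_cst _)))
    (measurable_funM (measurable_funB mu_ (measurable_cst _)) mv')).
have remle r : r \in `[s, t] -> `|rem r| <= (A * B + A * B) * (t - s).
  move=> rst; have rab := subitvcc as_ tb rst.
  move: rst; rewrite in_itv /= => /andP[sr rt].
  have rb := le_trans rt tb.
  have [_ dur] := incr _ _ _ _ _ mu' u'A intu' uE as_ sr rb.
  have [_ dvr] := incr _ _ _ _ _ mv' v'B intv' vE as_ sr rb.
  have rs : r - s <= t - s by apply: lerB.
  apply: le_trans (ler_normD _ _) _; rewrite !normrM mulrDl lerD //.
    rewrite -mulrA; apply: ler_pM => //; first exact: u'A.
    exact: le_trans dvr (ler_wpM2l B0 rs).
  rewrite mulrAC; apply: ler_pM => //; last exact: v'B.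
  exact: le_trans dur (ler_wpM2l A0 rs).
have subst (w : R -> R) := @integrable_subitv a b s t w as_ tb.
have intst (w : R -> R) W : measurable_fun `[a, b] w ->
    (forall s, s \in `[a, b] -> `|w s| <= W) ->
    mu.-integrable `[s, t] (EFin \o w).
  by move=> mw wW; apply: subst; exact: itvcc_integrable mw wW.
have mst : measurable (`[s, t]%classic : set R) by exact: measurable_itv.
have intrem : mu.-integrable `[s, t] (EFin \o rem).
  exact: itvcc_integrable (measurable_fun_subitv as_ tb mrem) remle.
have -> : \int[mu]_(r in `[s, t]) (u' r * v r + u r * v' r) =
    v s * (u t - u s) + u s * (v t - v s) + \int[mu]_(r in `[s, t]) rem r.
  rewrite (Rintegral_subr_lin (m := mu) (v s) (u s) mst (subst _ intd)
    (subst _ intu') (subst _ intv')) uts vts; congr (_ + _); first by ring.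
  by apply: eq_Rintegral => r _; rewrite /rem; ring.
rewrite (_ : _ - _ = (u t - u s) * (v t - v s) - \int[mu]_(r in `[s, t]) rem r);
  last by ring.
apply: le_trans (ler_normB _ _) _; rewrite [leRHS]mulrDl; apply: lerD.
  by rewrite normrM expr2 mulrACA ler_pM.
rewrite expr2 mulrA; apply: norm_Rintegral_itvcc => //.
exact: measurable_fun_subitv mrem.
Qed.

End calculus.

(** * Backward integral equations *)

Section backward_equations.
Context {R : realType}.
Notation mu := (@lebesgue_measure R).
Implicit Types (a b s t A B G K : R) (f g : R -> R).

(** Variation of constants: the product rule for the integrating factor times
    [h], with [h b = 0].  It is used with a pointwise bound on [g - alpha * h]. *)
Lemma backward_variation_of_constants a b (alpha g h : R -> R) A G : a <= b ->
  measurable_fun `[a, b] alpha ->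
  (forall s, s \in `[a, b] -> `|alpha s| <= A) ->
  measurable_fun `[a, b] g -> (forall s, s \in `[a, b] -> `|g s| <= G) ->
  (forall t, t \in `[a, b] -> h t = \int[mu]_(s in `[t, b]) g s) ->
  h a = \int[mu]_(s in `[a, b])
    (expR (\int[mu]_(v in `[a, s]) alpha v) * (g s - alpha s * h s)).
Proof.
move=> ab malpha alphaA mg gG hE.
have aab : a \in `[a, b] by rewrite in_itv /= lexx.
have bab : b \in `[a, b] by rewrite in_itv /= lexx ab.
have A0 : 0 <= A by apply: le_trans (alphaA a aab).
have intalpha := itvcc_integrable malpha alphaA.
have intg := itvcc_integrable mg gG.
pose E s := expR (\int[mu]_(v in `[a, s]) alpha v).
have mE : measurable_fun `[a, b] E.
  exact: measurable_expR_primitive.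
have maE : measurable_fun `[a, b] (fun s => alpha s * E s).
  exact: measurable_funM.
have aEle s : s \in `[a, b] -> `|alpha s * E s| <= A * expR (A * (b - a)).
  move=> sab; rewrite normrM ler_pM ?alphaA // ger0_norm ?expR_ge0 // ler_expR.
  move: sab; rewrite in_itv /= => /andP[as_ sb].
  apply: le_trans (ler_norm _) _.
  apply: (@le_trans _ _ (A * (s - a))); last by rewrite ler_wpM2l // lerD2r.
  apply: norm_Rintegral_itvcc => //.
    exact: measurable_fun_subitv malpha.
  by move=> r ras; apply: alphaA; exact: subitvcc (lexx a) sb _ ras.
have Ea : E a = 1 by rewrite /E Rintegral_itv11 expR0.
have hb : h b = 0 by rewrite hE // Rintegral_itv11.
have EE t : t \in `[a, b] -> E t = E a + \int[mu]_(s in `[a, t]) (alpha s * E s).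
  rewrite in_itv /= => /andP[at_ tb].
  have mat := measurable_fun_subitv (lexx a) tb malpha.
  have alphaAt r : r \in `[a, t] -> `|alpha r| <= A.
    by move=> rat; apply: alphaA; exact: subitvcc (lexx a) tb _ rat.
  have e : E t - E a = _ := expR_Rintegral at_ mat alphaAt.
  by apply: etrans (congr1 (fun z => E a + z) e); rewrite addrC subrK.
have hEE t : t \in `[a, b] -> - h t = - h a + \int[mu]_(s in `[a, t]) g s.
  by move=> tab; rewrite !hE // (Rintegral_itvcc_cat intg tab); ring.
rewrite (_ : h a = E b * - h b - E a * - h a); last by rewrite Ea hb; ring.
rewrite (Rintegral_product_rule ab maE aEle mg gG EE hEE).
by apply: eq_Rintegral => s _; rewrite -/(E s); ring.
Qed.

(** Gronwall's inequality, backward in time: variation of constants for the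
    primitive of [phi], with constant rate [K], bounds it by a primitive of
    [A * exp (K * (s - t))]. *)
Lemma backward_gronwall a b (phi : R -> R) A B K : 0 <= K -> 0 <= A ->
  measurable_fun `[a, b] phi -> (forall s, s \in `[a, b] -> `|phi s| <= B) ->
  (forall t, t \in `[a, b] -> phi t <= A + K * \int[mu]_(s in `[t, b]) phi s) ->
  forall t, t \in `[a, b] -> phi t <= A * expR (K * (b - t)).
Proof.
move=> K0 A0 mphi phiB phile t tab.
have := tab; rewrite in_itv /= => /andP[at_ tb].
have mphit := measurable_fun_subitv at_ (lexx b) mphi.
have phitB s : s \in `[t, b] -> `|phi s| <= B.
  by move=> stb; apply: phiB; exact: subitvcc at_ (lexx b) _ stb.
have intK s : t <= s -> \int[mu]_(v in `[t, s]) K = K * (s - t).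
  by move=> ts; rewrite Rintegral_cst // lebesgue_itvcc.
pose h s := \int[mu]_(r in `[s, b]) phi r.
have mtb : measurable (`[t, b]%classic : set R) by exact: measurable_itv.
have mh : measurable_fun `[t, b] h.
  exact: measurable_backward_primitive (itvcc_integrable mphit phitB).
pose E s := expR (\int[mu]_(v in `[t, s]) K).
have mE : measurable_fun `[t, b] E.
  apply: measurable_expR_primitive => //.
  by apply: (itvcc_integrable (B := K)) => // s _; rewrite ger0_norm.
have Ele s : s \in `[t, b] -> `|E s| <= expR (K * (b - t)).
  rewrite in_itv /= => /andP[ts sb]; rewrite ger0_norm ?expR_ge0 // ler_expR.
  by rewrite intK // ler_wpM2l // lerD2r.
have hB s : s \in `[t, b] -> `|h s| <= B * (b - t).
  move=> stb; have := stb; rewrite in_itv /= => /andP[ts sb].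
  have B0 : 0 <= B by apply: le_trans (phitB s stb).
  apply: le_trans (norm_Rintegral_itvcc (B := B) sb _ _) _.
  - exact: measurable_fun_subitv mphit.
  - by move=> r rsb; apply: phitB; exact: subitvcc ts (lexx b) _ rsb.
  - by rewrite ler_wpM2l // lerB.
have KK s : s \in `[t, b] -> `|K| <= K by rewrite ger0_norm.
have hE : h t = \int[mu]_(s in `[t, b]) (E s * (phi s - K * h s)).
  by apply: backward_variation_of_constants KK mphit phitB _.
have mg : measurable_fun `[t, b] (fun s => E s * (phi s - K * h s)).
  exact: (measurable_funM mE (measurable_funB mphit
    (measurable_funM (measurable_cst _) mh))).
have hle : h t <= \int[mu]_(s in `[t, b]) (A * E s).
  rewrite hE; apply: (le_Rintegral (mu := mu) mtb).
  - apply: (itvcc_integrable (B := expR (K * (b - t)) * (B + K * (B * (b - t)))) mg).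
    move=> s stb; rewrite normrM ler_pM ?Ele //.
    apply: le_trans (ler_normB _ _) _; apply: lerD; first exact: phitB.
    by rewrite normrM ger0_norm // ler_wpM2l // hB.
  - apply: (itvcc_integrable (B := A * expR (K * (b - t)))
      (measurable_funM (measurable_cst _) mE)) => s stb.
    by rewrite normrM ger0_norm // ler_wpM2l // Ele.
  - move=> s stb; rewrite mulrC ler_wpM2r ?expR_ge0 // lerBlDr.
    by apply: phile; exact: subitvcc at_ (lexx b) _ stb.
apply: le_trans (phile t tab) _; rewrite -/(h t).
apply: (@le_trans _ _ (A + K * \int[mu]_(s in `[t, b]) (A * E s))).
  by rewrite lerD2l ler_wpM2l.
have intE := itvcc_integrable mE Ele.
rewrite (RintegralZl (mu := mu) A mtb intE) mulrCA.
rewrite -(RintegralZl (mu := mu) K mtb intE).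
have e : E b - E t = \int[mu]_(s in `[t, b]) (K * E s).
  exact: (expR_Rintegral tb (measurable_cst _) KK).
have Eb : E b = expR (K * (b - t)) by rewrite /E intK.
have Et : E t = 1 by rewrite /E Rintegral_itv11 expR0.
by rewrite -e Eb Et mulrBr mulr1 addrC subrK.
Qed.

(** Used with [U] a solution, which gives a bound for it, and with [U] a
    difference of two solutions, where [d] measures the change of the data. *)
Lemma backward_stability a b (U g d : R -> R) K : a <= b -> 0 <= K ->
  mu.-integrable `[a, b] (EFin \o g) -> mu.-integrable `[a, b] (EFin \o d) ->
  (forall s, s \in `[a, b] -> 0 <= d s) ->
  (forall t, t \in `[a, b] -> U t = \int[mu]_(s in `[t, b]) g s) ->
  (forall s, s \in `[a, b] -> `|g s| <= d s + K * `|U s|) ->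
  measurable_fun `[a, b] U /\
  forall t, t \in `[a, b] ->
    `|U t| <= (\int[mu]_(s in `[a, b]) d s) * expR (K * (b - t)).
Proof.
move=> ab K0 intg intd d0 UE gle.
have mU : measurable_fun `[a, b] U.
  apply: (eq_measurable_fun (fun t => \int[mu]_(s in `[t, b]) g s)).
    by move=> t; rewrite inE => tab; rewrite UE.
  exact: measurable_backward_primitive.
have mab : measurable (`[a, b]%classic : set R) by exact: measurable_itv.
have mtb t : measurable (`[t, b]%classic : set R) by exact: measurable_itv.
have nintg : mu.-integrable `[a, b] (EFin \o (fun s => `|g s|)).
  exact: integrable_norm intg.
have le_total (w : R -> R) t : mu.-integrable `[a, b] (EFin \o w) ->
    (forall s, s \in `[a, b] -> 0 <= w s) -> t \in `[a, b] ->
    \int[mu]_(s in `[t, b]) w s <= \int[mu]_(s in `[a, b]) w s.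
  move=> intw w0 tab; have := tab; rewrite in_itv /= => /andP[at_ tb].
  rewrite (Rintegral_itvcc_cat intw tab) lerDr; apply: Rintegral_ge0 => s sat.
  by apply: w0; exact: subitvcc (lexx a) tb _ sat.
have Ule t : t \in `[a, b] -> `|U t| <= \int[mu]_(s in `[t, b]) `|g s|.
  move=> tab; have := tab; rewrite in_itv /= => /andP[at_ tb].
  rewrite UE //; apply: (le_normr_Rintegral (mu := mu) (mtb t)).
  exact: integrable_subitv intg.
have UB t : t \in `[a, b] -> `|U t| <= \int[mu]_(s in `[a, b]) `|g s|.
  by move=> tab; apply: le_trans (Ule t tab) _; exact: le_total.
have mnU : measurable_fun `[a, b] (fun s => `|U s|) by exact: measurableT_comp.
have nUB t : t \in `[a, b] -> `|(`|U t|)| <= \int[mu]_(s in `[a, b]) `|g s|.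
  by move=> tab; rewrite normr_id UB.
split=> //; apply: (backward_gronwall K0 _ mnU nUB).
  by apply: Rintegral_ge0 => s; exact: d0.
move=> t tab; have := tab; rewrite in_itv /= => /andP[at_ tb].
apply: le_trans (Ule t tab) _.
have intnU := itvcc_integrable mnU nUB.
have i1 := integrable_subitv at_ (lexx b) intd.
have i2 := integrable_subitv at_ (lexx b) intnU.
have i3 := integrable_mulr (m := mu) K (mtb t) i2.
apply: (@le_trans _ _ (\int[mu]_(s in `[t, b]) (d s + `|U s| * K))).
  apply: (le_Rintegral (mu := mu) (mtb t)).
  - exact: integrable_subitv nintg.
  - have := integrableD (mu := mu) (mtb t) i1 i3.
    by apply: (eq_integrable (mu := mu) (mtb t)) => s _ /=; rewrite -EFinD.
  - move=> s stb; rewrite [_ * K]mulrC; apply: gle.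
    exact: subitvcc at_ (lexx b) _ stb.
rewrite (RintegralD (mu := mu) (mtb t) i1 i3) (RintegralZr (mu := mu) K (mtb t) i2).
by rewrite [_ * K]mulrC lerD2r; exact: le_total.
Qed.

(** Integration divides the weight [exp (K * (b - s))] by at least [K]: this
    makes Picard's map below a contraction in a weighted norm. *)
Lemma Rintegral_expR_weight K t b : 0 < K -> t <= b ->
  mu.-integrable `[t, b] (EFin \o (fun s => expR (K * (b - s)))) /\
  \int[mu]_(s in `[t, b]) expR (K * (b - s)) <= expR (K * (b - t)) / K.
Proof.
move=> K0 tb; pose E s := expR (\int[mu]_(v in `[t, s]) - K).
have intK s : t <= s -> \int[mu]_(v in `[t, s]) - K = - K * (s - t).
  by move=> ts; rewrite Rintegral_cst // lebesgue_itvcc.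
have KK s : s \in `[t, b] -> `|- K| <= K by rewrite normrN gtr0_norm.
have mtb : measurable (`[t, b]%classic : set R) by exact: measurable_itv.
have mE : measurable_fun `[t, b] E.
  exact: measurable_expR_primitive tb (itvcc_integrable (measurable_cst _) KK).
have E1 s : s \in `[t, b] -> `|E s| <= 1.
  rewrite in_itv /= => /andP[ts _]; rewrite ger0_norm ?expR_ge0 //.
  by rewrite -[leRHS]expR0 ler_expR intK // mulNr oppr_le0 mulr_ge0 ?subr_ge0 // ltW.
have intE := itvcc_integrable mE E1.
have wE s : s \in `[t, b] -> expR (K * (b - s)) = E s * expR (K * (b - t)).
  rewrite in_itv /= => /andP[ts _]; rewrite /E intK // -expRD; congr expR; ring.
have e : E b - E t = \int[mu]_(s in `[t, b]) (- K * E s).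
  exact: (expR_Rintegral tb (measurable_cst _) KK).
split.
  have := integrable_mulr (m := mu) (expR (K * (b - t))) mtb intE.
  by apply: (eq_integrable (mu := mu) mtb) => s; rewrite inE => stb /=; rewrite (wE s).
have -> : \int[mu]_(s in `[t, b]) expR (K * (b - s)) =
    \int[mu]_(s in `[t, b]) (E s * expR (K * (b - t))).
  by apply: eq_Rintegral => s; rewrite inE; exact: wE.
rewrite (RintegralZr (mu := mu) _ mtb intE) mulrC ler_wpM2l ?expR_ge0 //.
move: e; rewrite (RintegralZl (mu := mu) _ mtb intE).
have -> : E t = 1 by rewrite /E Rintegral_itv11 expR0.
have : 0 <= E b by exact: expR_ge0.
move=> Eb e; rewrite -[leRHS]mul1r ler_pdivlMr //; lra.
Qed.

(** Picard iteration: the increments of the iterates are halved at each step in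
    the norm with weight [exp (2 * K * (b - t))], so the iterates converge
    pointwise while staying bounded, and the integral passes to the limit. *)
Lemma backward_equation_solvable a b (F : R -> R -> R) G K : a <= b -> 0 < K ->
  (forall U : R -> R, measurable_fun `[a, b] U ->
     measurable_fun `[a, b] (fun s => F s (U s))) ->
  (forall s u u', s \in `[a, b] -> `|F s u - F s u'| <= K * `|u - u'|) ->
  (forall s, s \in `[a, b] -> `|F s 0| <= G) ->
  exists U : R -> R, mu.-integrable `[a, b] (EFin \o (fun s => F s (U s))) /\
    forall t, t \in `[a, b] -> U t = \int[mu]_(s in `[t, b]) F s (U s).
Proof.
move=> ab K0 mF FK FG.
have G0 : 0 <= G by apply: le_trans (FG a _); rewrite // in_itv /= lexx.
have FB (U : R -> R) B s : s \in `[a, b] -> `|U s| <= B -> `|F s (U s)| <= G + K * B.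
  move=> sab UB; rewrite -[F s _](subrK (F s 0)) addrC.
  apply: le_trans (ler_normD _ _) _; apply: lerD; first exact: FG.
  by apply: le_trans (FK _ _ _ sab) _; rewrite subr0 ler_wpM2l // ltW.
pose Phi (U : R -> R) t := \int[mu]_(s in `[t, b]) F s (U s).
pose U_ n := iter n Phi (fun=> 0).
pose w t := expR (2 * K * (b - t)); pose c := G * (b - a).
have c0 : 0 <= c by rewrite mulr_ge0 ?subr_ge0.
have w0 t : 0 <= w t by exact: expR_ge0.
have wle t : t \in `[a, b] -> w t <= w a.
  rewrite in_itv /= => /andP[at_ _].
  rewrite ler_expR; apply: ler_wpM2l; last exact: lerB.
  by apply: mulr_ge0 => //; exact: ltW.
have mint (U : R -> R) B : measurable_fun `[a, b] U ->
    (forall s, s \in `[a, b] -> `|U s| <= B) ->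
    mu.-integrable `[a, b] (EFin \o (fun s => F s (U s))).
  move=> mU UB; apply: (itvcc_integrable (B := G + K * B)) => [|s sab].
    exact: mF.
  exact: FB sab (UB s sab).
have PhiB (U : R -> R) B t : measurable_fun `[a, b] U ->
    (forall s, s \in `[a, b] -> `|U s| <= B) -> t \in `[a, b] ->
    `|Phi U t| <= (G + K * B) * (b - a).
  move=> mU UB tab; have := tab; rewrite in_itv /= => /andP[at_ tb].
  have B0 : 0 <= B by exact: le_trans (UB t tab).
  apply: (@le_trans _ _ ((G + K * B) * (b - t))).
    apply: norm_Rintegral_itvcc => //.
      exact: measurable_fun_subitv at_ (lexx b) (mF _ mU).
    move=> s stb; have sab := subitvcc at_ (lexx b) stb.
    exact: FB sab (UB s sab).
  apply: ler_wpM2l; last exact: lerB.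
  exact: addr_ge0 G0 (mulr_ge0 (ltW K0) B0).
have invU n : measurable_fun `[a, b] (U_ n) /\
    exists B, forall s, s \in `[a, b] -> `|U_ n s| <= B.
  elim: n => [|n [mUn [B UnB]]].
    by split; [exact: measurable_cst|exists 0 => s _; rewrite normr0].
  split; first exact: measurable_backward_primitive ab (mint _ _ mUn UnB).
  by exists ((G + K * B) * (b - a)) => s sab; exact: PhiB mUn UnB sab.
have intU n : mu.-integrable `[a, b] (EFin \o (fun s => F s (U_ n s))).
  by have [mUn [B UnB]] := invU n; exact: mint mUn UnB.
have incr n t : t \in `[a, b] -> `|U_ n.+1 t - U_ n t| <= c / 2 ^+ n * w t.
  elim: n t => [t tab|n IH t tab].
    rewrite expr0 divr1 /= subr0; apply: (@le_trans _ _ c).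
      have := PhiB (fun=> 0) 0 t (measurable_cst _); rewrite mulr0 addr0.
      by apply => // s _; rewrite normr0.
    rewrite -[leLHS]mulr1 ler_wpM2l // -expR0 ler_expR.
    by move: tab; rewrite in_itv /= => /andP[_ tb]; rewrite !mulr_ge0 ?subr_ge0 ?(ltW K0).
  have := tab; rewrite in_itv /= => /andP[at_ tb].
  have mtb : measurable (`[t, b]%classic : set R) by exact: measurable_itv.
  have i1 := integrable_subitv at_ (lexx b) (intU n.+1).
  have i2 := integrable_subitv at_ (lexx b) (intU n).
  have i12 := integrable_subr (m := mu) mtb i1 i2.
  have K20 : 0 < 2 * K by rewrite mulr_gt0.
  have [iw lew] := Rintegral_expR_weight K20 tb.
  have i3 := integrable_mulr (m := mu) (K * (c / 2 ^+ n)) mtb iw.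
  rewrite (_ : _ - _ = \int[mu]_(s in `[t, b]) (F s (U_ n.+1 s) - F s (U_ n s)));
    last by rewrite (RintegralB (mu := mu) mtb i1 i2).
  apply: le_trans (le_normr_Rintegral (mu := mu) mtb i12) _.
  apply: (@le_trans _ _ (\int[mu]_(s in `[t, b]) (w s * (K * (c / 2 ^+ n))))).
    apply: (le_Rintegral (mu := mu) mtb) => //; first exact: integrable_norm.
    move=> s stb; have sab := subitvcc at_ (lexx b) stb.
    apply: le_trans (FK _ _ _ sab) _; rewrite mulrCA ler_wpM2l ?(ltW K0) //.
    by rewrite mulrC; exact: IH.
  rewrite (RintegralZr (mu := mu) _ mtb iw).
  apply: (@le_trans _ _ (w t / (2 * K) * (K * (c / 2 ^+ n)))).
    by rewrite ler_wpM2r // mulr_ge0 ?(ltW K0) // divr_ge0 // exprn_ge0.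
  rewrite le_eqVlt; apply/orP; left; apply/eqP; rewrite exprS.
  have := expf_neq0 n (_ : (2 : R) != 0).
  by move=> h; field; rewrite h // gt_eqF.
have bndU n t : t \in `[a, b] -> `|U_ n t| <= (2 - 2 / 2 ^+ n) * (c * w t).
  move=> tab; elim: n => [|n IH]; first by rewrite normr0 expr0 divr1 subrr mul0r.
  rewrite -[U_ n.+1 t](subrK (U_ n t)).
  apply: le_trans (ler_normD _ _) (le_trans (lerD (incr n t tab) IH) _).
  rewrite le_eqVlt; apply/orP; left; apply/eqP; rewrite exprS.
  have := expf_neq0 n (_ : (2 : R) != 0).
  by move=> h; field; rewrite h.
pose B := 2 * (c * w a).
have UB n t : t \in `[a, b] -> `|U_ n t| <= B.
  move=> tab; apply: le_trans (bndU n t tab) _; apply: ler_pM.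
  - rewrite subr_ge0 ler_pdivrMr ?exprn_gt0 // ler_peMr //.
    by rewrite exprn_ege1 // ler1n.
  - by rewrite mulr_ge0.
  - by rewrite lerBlDr lerDl divr_ge0.
  - by rewrite ler_wpM2l // wle.
have cvgU t : t \in `[a, b] -> cvgn (fun n => U_ n t).
  move=> tab; pose u n := U_ n t.
  rewrite (_ : (fun n => _) = (fun n => u 0%N + series (telescope u) n));
    last by apply/funext => n; rewrite -eq_sum_telescope.
  apply: is_cvgD; first exact: is_cvg_cst.
  apply: normed_cvg.
  apply: (@series_le_cvg _ _ (geometric (c * w t) 2^-1)) => [n|n|n|].
  - exact: normr_ge0.
  - by apply: mulr_ge0; [exact: mulr_ge0|rewrite exprn_ge0 // invr_ge0].
  - by rewrite /= exprVn mulrAC; exact: incr.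
  - apply: is_cvg_geometric_series; rewrite ger0_norm ?invr_ge0 //.
    by rewrite invf_lt1 // ltr1n.
pose U t := lim (U_ n t @[n --> \oo]).
have cvgF s : s \in `[a, b] -> F s (U_ n s) @[n --> \oo] --> F s (U s).
  move=> sab; apply: (cvg_dist_le (fun n => FK _ _ _ sab)).
  rewrite -[X in _ --> X](mulr0 K); apply: cvgMl_tmp.
  by apply/norm_cvg0P; apply/subr_cvg0; exact: cvgU.
have mU : measurable_fun `[a, b] U.
  apply: (measurable_fun_cvg (h := U_)) => [n|s sab]; first by have [] := invU n.
  exact: cvgU.
have UUB s : s \in `[a, b] -> `|U s| <= B.
  move=> sab; rewrite ler_norml; apply/andP; split.
    by apply: limr_ge (cvgU s sab) _; apply: nearW => n; have := UB n s sab;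
      rewrite ler_norml => /andP[].
  by apply: limr_le (cvgU s sab) _; apply: nearW => n; have := UB n s sab;
    rewrite ler_norml => /andP[].
exists U; split; first exact: mint mU UUB.
move=> t tab; have := tab; rewrite in_itv /= => /andP[at_ tb].
have cvg1 : U_ n.+1 t @[n --> \oo] --> \int[mu]_(s in `[t, b]) F s (U s).
  apply: (bounded_convergence (m := mu) (B := G + K * B)) => //.
  - exact: lebesgue_itvcc_lty.
  - move=> n; apply: measurable_fun_subitv at_ (lexx b) (mF _ _).
    by have [] := invU n.
  - move=> n s stb; have sab := subitvcc at_ (lexx b) stb.
    exact: FB sab (UB n s sab).
  - by move=> s stb; apply: cvgF; exact: subitvcc at_ (lexx b) _ stb.
have := cvg1; rewrite (cvg_shiftS (fun n => U_ n t)) => /cvg_lim; apply.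
exact: Rhausdorff.
Qed.
End backward_equations.

(** * Measurability of compositions *)

Section caratheodory_functions.
Context d (X : measurableType d) (R : realType).

Lemma measurable_floor : measurable_fun [set: R] (fun x => (Num.floor x)%:~R : R).
Proof.
apply: nondecreasing_measurable => // x y xy.
by rewrite ler_int; exact: le_floor.
Qed.

(** The argument [x s] is approximated from the right by functions with values
    in the discrete set of multiples of [1 / n], and a countable partition of
    [D] reduces these to measurability in [s] at a fixed argument. *)
Lemma measurable_fun_caratheodory (D : set X) (F : X -> R -> R) (x : X -> R) :
  measurable D -> (forall y, measurable_fun D (F ^~ y)) -> measurable_fun D x ->
  (forall s, D s -> F s y @[y --> (x s)^'+] --> F s (x s)) ->
  measurable_fun D (fun s => F s (x s)).
Proof.
move=> mD mF mx Fx.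
pose g (n : nat) s : R := (Num.floor (n.+1%:R * x s))%:~R.
pose y n s := (g n s + 1) / n.+1%:R.
have mg n : measurable_fun D (g n).
  apply: (measurableT_comp measurable_floor).
  exact: (measurable_funM (measurable_cst _) mx).
have xy n s : x s < y n s.
  rewrite ltr_pdivlMr ?ltr0n // mulrC.
  by have /andP[_] := floor_itv (n.+1%:R * x s); rewrite intrD.
have yx n s : y n s <= x s + n.+1%:R^-1.
  rewrite ler_pdivrMr ?ltr0n // mulrDl mulVf ?pnatr_eq0 // lerD2r mulrC.
  by have /andP[] := floor_itv (n.+1%:R * x s).
apply: (measurable_fun_cvg (h := fun n s => F s (y n s))) => [n|s Ds].
  pose c (i : nat) : R := (odflt 0 (unpickle i : option int))%:~R.
  have -> : D = \bigcup_i (D `&` g n @^-1` [set c i]).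
    rewrite -setI_bigcupr; apply/esym/setIidl => s _.
    by exists (pickle (Num.floor (n.+1%:R * x s))) => //; rewrite /= /c pickleK.
  apply/measurable_fun_bigcup => i; first exact: mg.
  apply: (eq_measurable_fun (F ^~ ((c i + 1) / n.+1%:R))).
    by move=> s; rewrite inE => -[_ gs]; rewrite /y gs.
  by apply: measurable_funS (mF _) => //; exact: subIsetl.
have cvgy : y n s @[n --> \oo] --> (x s)^'+.
  have yn : y n s @[n --> \oo] --> x s.
    apply: (cvg_dist_le (e := harmonic)) (@cvg_harmonic R) => n.
    by rewrite ger0_norm ?subr_ge0 ?(ltW (xy n s)) // lerBlDl yx.
  move=> A /= /yn yA.
  have {}yA : \forall n \near \oo, x s < y n s -> A (y n s) := yA.
  by apply: filterS yA => n; apply; exact: xy.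
exact: cvg_comp cvgy (Fx s Ds).
Qed.

End caratheodory_functions.

(** * The aggregator at a fixed time *)

Section aggregator.
Context (R : realType) (T : R) (f : R -> R -> R -> R).
Hypothesis fT : aggregator_assumptions T f.
Implicit Types s y u z v l B K : R.

Lemma cvg_dnbhs_seq (X : topologicalType) (x : X) (u_ : nat -> X) :
  (forall n, u_ n != x) -> u_ n @[n --> \oo] --> x -> u_ n @[n --> \oo] --> x^'.
Proof. exact: (cvg_within_forall (A := fun t => t != x)). Qed.

Lemma cvg_partial_y s y u (z : nat -> R) : s \in `[0, T] -> 0 <= y ->
  (forall n, 0 <= z n) -> (forall n, z n != y) -> z n @[n --> \oo] --> y ->
  quotient_y f s y u (z n) @[n --> \oo] --> partial_y f s y u.
Proof.
move=> sT y0 z0 zy cvgz.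
have [/(_ y u y0)[cvgq _] _ _] := aggregator_C1 fT sT.
apply: cvg_comp cvgq => B /= /(cvg_dnbhs_seq zy cvgz) zB.
have {}zB : \forall n \near \oo, 0 <= z n -> B (z n) := zB.
by apply: filterS zB => n; exact.
Qed.

Lemma cvg_partial_u s y u (h : nat -> R) : s \in `[0, T] -> 0 <= y ->
  (forall n, h n != 0) -> h n @[n --> \oo] --> 0 ->
  (f s y (u + h n) - f s y u) / h n @[n --> \oo] --> partial_u f s y u.
Proof.
move=> sT y0 h0 cvgh.
have [/(_ y u y0)[_ dfu] _ _] := aggregator_C1 fT sT.
rewrite /partial_u derive1E.
have := cvg_comp _ _ (cvg_dnbhs_seq h0 cvgh) dfu.
apply: cvg_trans; apply: near_eq_cvg; apply: nearW => n /=.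
by rewrite /GRing.scale /= mulr1 mulrC (addrC u).
Qed.

Lemma cvg_harmonic2 : (n.+2%:R^-1 : R) @[n --> \oo] --> 0.
Proof. by have := @cvg_harmonic R; rewrite -cvg_shiftS. Qed.

Lemma harmonic2_itv n : 0 < (n.+2%:R^-1 : R) < 1.
Proof. by rewrite invr_gt0 ltr0n /= invf_lt1 ?ltr0n // ltr1n. Qed.

Lemma cvg_segment (a b : R) : a + n.+2%:R^-1 * b @[n --> \oo] --> a.
Proof.
have := cvgD (cvg_cst a) (cvgMr_tmp (b := b) cvg_harmonic2).
rewrite mul0r addr0; exact.
Qed.

Lemma aggregator_concave_segment s y u z v l : s \in `[0, T] -> 0 <= y -> 0 <= z ->
  (z, v) <> (y, u) -> 0 < l < 1 ->
  f s z v - f s y u <= (f s (y + l * (z - y)) (u + l * (v - u)) - f s y u) / l.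
Proof.
move=> sT y0 z0 zy l01; have /andP[l0 l1] := l01.
have := aggregator_concave fT sT z0 y0 zy l01.
rewrite (_ : l * z + (1 - l) * y = y + l * (z - y)); last by ring.
rewrite (_ : l * v + (1 - l) * u = u + l * (v - u)); last by ring.
by move=> h; rewrite ler_pdivlMr //; lra.
Qed.

Lemma aggregator_tangent_y s y u z : s \in `[0, T] -> 0 <= y -> 0 <= z ->
  f s z u - f s y u <= partial_y f s y u * (z - y).
Proof.
move=> sT y0 z0; have [->|zy] := eqVneq z y; first by rewrite !subrr mulr0.
pose l n : R := n.+2%:R^-1; pose x n := y + l n * (z - y).
have xy n : x n - y = l n * (z - y) by rewrite /x; ring.
have l0 n : l n != 0 by rewrite gt_eqF // (andP (harmonic2_itv n)).1.
have cvgx : x n @[n --> \oo] --> y.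
  exact: cvg_segment.
have x0 n : 0 <= x n.
  rewrite (_ : x n = l n * z + (1 - l n) * y); last by rewrite /x; ring.
  have /andP[a b] := harmonic2_itv n.
  by rewrite addr_ge0 // mulr_ge0 // ?subr_ge0 ltW.
have xny n : x n != y by rewrite -subr_eq0 xy mulf_neq0 // subr_eq0.
have cvgq := cvg_partial_y (u := u) sT y0 x0 xny cvgx.
apply: (ler_cvg_to (f := fun=> f s z u - f s y u) (cvg_cst _)
  (cvgMr_tmp (b := z - y) cvgq)).
apply: nearW => n.
have zuyu : (z, u) <> (y, u) by case=> zy'; rewrite zy' eqxx in zy.
have := aggregator_concave_segment sT y0 z0 zuyu (harmonic2_itv n).
rewrite subrr mulr0 addr0 -/(l n) -/(x n) => /le_trans; apply.
rewrite /quotient_y xy; set d := f s (x n) u - f s y u.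
rewrite (_ : d / (l n * (z - y)) * (z - y) = d / l n) //.
by field; rewrite l0 subr_eq0 zy.
Qed.

Lemma cvg_partial_y_joint s y u (z v : nat -> R) : s \in `[0, T] -> 0 <= y ->
  (forall n, 0 <= z n) -> z n @[n --> \oo] --> y -> v n @[n --> \oo] --> u ->
  partial_y f s (z n) (v n) @[n --> \oo] --> partial_y f s y u.
Proof.
move=> sT y0 z0 zy vu; have [_ + _] := aggregator_C1 fT sT.
move=> /subspace_continuousP /(_ (y, u) y0) c.
have zv : (z n, v n) @[n --> \oo] --> within [set p : R * R | 0 <= p.1] (nbhs (y, u)).
  apply: cvg_within_forall => [n|]; first exact: z0.
  exact: (cvg_pair zy vu).
exact: cvg_comp zv c.
Qed.

Lemma cvg_partial_u_joint s y u (z v : nat -> R) : s \in `[0, T] -> 0 <= y ->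
  (forall n, 0 <= z n) -> z n @[n --> \oo] --> y -> v n @[n --> \oo] --> u ->
  partial_u f s (z n) (v n) @[n --> \oo] --> partial_u f s y u.
Proof.
move=> sT y0 z0 zy vu; have [_ _ +] := aggregator_C1 fT sT.
move=> /subspace_continuousP /(_ (y, u) y0) c.
have zv : (z n, v n) @[n --> \oo] --> within [set p : R * R | 0 <= p.1] (nbhs (y, u)).
  apply: cvg_within_forall => [n|]; first exact: z0.
  exact: (cvg_pair zy vu).
exact: cvg_comp zv c.
Qed.

(** A concave function lies below its tangent plane.  The slope of [f] between
    [(y, u)] and [(z, v)] is at most its slope over the initial share [l] of the segment.
    There the increment in [y] is bounded by the tangent in [y] alone at the
    value [u + l * (v - u)], and the partial derivative in [y] is jointly
    continuous, so that both parts have a limit as [l] tends to 0. *)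
Lemma aggregator_tangent s y u z v : s \in `[0, T] -> 0 <= y -> 0 <= z ->
  f s z v - f s y u <= partial_y f s y u * (z - y) + partial_u f s y u * (v - u).
Proof.
move=> sT y0 z0; have [->|vu] := eqVneq v u.
  by rewrite (subrr u) mulr0 addr0; exact: aggregator_tangent_y.
pose l n : R := n.+2%:R^-1; pose h n := l n * (v - u).
have l01 n : 0 < l n < 1 := harmonic2_itv n.
have l0 n : l n != 0 by rewrite gt_eqF // (andP (l01 n)).1.
have h0 n : h n != 0 by rewrite mulf_neq0 // subr_eq0.
have cvgh : h n @[n --> \oo] --> 0.
  by have := cvgMr_tmp (b := v - u) cvg_harmonic2; rewrite mul0r; exact.
have cvg1 := cvg_partial_y_joint sT y0 (fun=> y0) (cvg_cst y) (@cvg_segment u (v - u)).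
have cvg2 := cvg_partial_u (u := u) sT y0 h0 cvgh.
have cvg3 : partial_y f s y (u + l n * (v - u)) * (z - y)
    + (f s y (u + h n) - f s y u) / h n * (v - u) @[n --> \oo]
    --> partial_y f s y u * (z - y) + partial_u f s y u * (v - u).
  apply: cvgD; [apply: cvgMr_tmp; exact: cvg1|apply: cvgMr_tmp; exact: cvg2].
apply: (ler_cvg_to (f := fun=> f s z v - f s y u) (cvg_cst _) cvg3).
apply: nearW => n /=; rewrite -/(l n) -/(h n).
apply: le_trans (aggregator_concave_segment sT y0 z0 _ (l01 n)) _.
  by case=> _ vu'; rewrite vu' eqxx in vu.
have /andP[ln0 ln1] := l01 n; rewrite -/(h n).
have x0 : 0 <= y + l n * (z - y).
  rewrite (_ : y + _ = l n * z + (1 - l n) * y); last by ring.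
  by rewrite addr_ge0 // mulr_ge0 // ?subr_ge0 ltW.
rewrite ler_pdivrMr // mulrDl.
rewrite (_ : (_ / h n * _) * l n = f s y (u + h n) - f s y u); last first.
  by rewrite /h; field; rewrite l0 subr_eq0 vu.
have := aggregator_tangent_y (u + h n) sT y0 x0.
by rewrite addrAC subrr add0r mulrA mulrAC; lra.
Qed.

(** Strict monotonicity alone would allow a zero derivative; with concavity the
    derivative is at least the increment over a unit step. *)
Lemma partial_y_gt0 s y u : s \in `[0, T] -> 0 <= y -> 0 < partial_y f s y u.
Proof.
move=> sT y0; have y10 : 0 <= y + 1 by rewrite addr_ge0.
have := aggregator_tangent_y u sT y0 y10; rewrite addrAC subrr add0r mulr1.
apply: lt_le_trans; rewrite subr_gt0.
by apply: (aggregator_increasing fT) => //; rewrite ltrDl.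
Qed.

Lemma aggregator_nondecreasing s u y y' : s \in `[0, T] -> 0 <= y -> y <= y' ->
  f s y u <= f s y' u.
Proof.
move=> sT y0; rewrite le_eqVlt => /predU1P[->//|yy'].
exact/ltW/(aggregator_increasing fT).
Qed.

Lemma partial_u_bounded K s y u :
  (forall s y u u', s \in `[0, T] -> 0 <= y ->
     `|f s y u - f s y u'| <= K * `|u - u'|) ->
  s \in `[0, T] -> 0 <= y -> `|partial_u f s y u| <= K.
Proof.
move=> fK sT y0; pose h n : R := n.+2%:R^-1.
have h0 n : h n != 0 by rewrite gt_eqF // (andP (harmonic2_itv n)).1.
have q n : `|(f s y (u + h n) - f s y u) / h n| <= K.
  rewrite normrM normfV ler_pdivrMr ?normr_gt0 //.
  by apply: le_trans (fK _ _ _ _ sT y0) _; rewrite addrAC subrr add0r.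
have cvgq := cvg_partial_u (u := u) sT y0 h0 cvg_harmonic2.
rewrite ler_norml; apply/andP; split.
  apply: (ler_cvg_to (cvg_cst (- K)) cvgq); apply: nearW => n.
  by have := q n; rewrite ler_norml => /andP[].
apply: (ler_cvg_to cvgq (cvg_cst K)); apply: nearW => n.
by have := q n; rewrite ler_norml => /andP[].
Qed.

Lemma aggregator_cvg_y s y u (z : nat -> R) : s \in `[0, T] -> 0 <= y ->
  (forall n, 0 <= z n) -> z n @[n --> \oo] --> y ->
  f s (z n) u @[n --> \oo] --> f s y u.
Proof.
move=> sT y0 z0 zy.
apply: (cvg_dist_le
  (e := fun n => (partial_y f s y u + partial_y f s (z n) u) * `|z n - y|)).
  move=> n; have t1 := aggregator_tangent_y u sT y0 (z0 n).
  have t2 := aggregator_tangent_y u sT (z0 n) y0.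
  have p1 := partial_y_gt0 u sT y0; have p2 := partial_y_gt0 u sT (z0 n).
  have [yz|zy'] := leP y (z n).
    have := aggregator_nondecreasing u sT y0 yz => fyz.
    by rewrite !ger0_norm ?subr_ge0 //; nra.
  have := aggregator_nondecreasing u sT (z0 n) (ltW zy') => fyz.
  by rewrite ler0_norm ?subr_le0 // ltr0_norm ?subr_lt0 //; nra.
have c1 : partial_y f s y u + partial_y f s (z n) u @[n --> \oo]
    --> partial_y f s y u + partial_y f s y u.
  apply: cvgD; first exact: cvg_cst.
  exact: (cvg_partial_y_joint sT y0 z0 zy (cvg_cst u)).
have c2 : `|z n - y| @[n --> \oo] --> 0.
  by apply/norm_cvg0P; apply/subr_cvg0.
by have := cvgM c1 c2; rewrite mulr0; exact.
Qed.

(** From the right the tangent at [y] alone gives the upper bound; this is the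
    one-sided continuity that measurability of compositions asks for, and it
    makes sense at the boundary [y = 0]. *)
Lemma aggregator_right_cvg_y s y u : s \in `[0, T] -> 0 <= y ->
  f s z u @[z --> y^'+] --> f s y u.
Proof.
move=> sT y0.
have c : f s y u + partial_y f s y u * (z - y) @[z --> y^'+] -->
    f s y u + partial_y f s y u * (y - y).
  apply: cvgD; first exact: cvg_cst.
  apply: cvgMl_tmp; apply: cvgB; last exact: cvg_cst.
  exact: cvg_at_right_filter cvg_id.
rewrite subrr mulr0 addr0 in c.
apply: squeeze_cvgr (cvg_cst _) c; near=> z.
have yz : y < z by near: z; exact: nbhs_right_gt.
rewrite (aggregator_nondecreasing u sT y0 (ltW yz)) /= -lerBlDl.
by apply: aggregator_tangent_y => //; exact: le_trans (ltW yz).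
Unshelve. all: by end_near.
Qed.

Lemma aggregator_continuous_u s y : s \in `[0, T] -> 0 <= y -> continuous (f s y).
Proof.
move=> sT y0 u; have [K [K0 fK]] := aggregator_lipschitz fT.
apply/cvgrPdist_le => e e0; near=> v.
apply: le_trans (fK _ _ _ _ sT y0) _.
rewrite mulrC -ler_pdivlMr //; near: v.
exact: (cvgr_dist_le _ _ (@cvg_id _ (nbhs u))) (divr_gt0 e0 K0).
Unshelve. all: by end_near.
Qed.

Lemma measurable_aggregator (Y U : R -> R) : measurable_fun `[0, T] Y ->
  measurable_fun `[0, T] U -> (forall s, s \in `[0, T] -> 0 <= Y s) ->
  measurable_fun `[0, T] (fun s => f s (Y s) (U s)).
Proof.
move=> mY mU Y0.
have mfY u : measurable_fun `[0, T] (fun s => f s (Y s) u).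
  apply: (eq_measurable_fun (fun s => f s (Num.max 0 (Y s)) u)).
    by move=> s; rewrite inE => sT; rewrite max_r // Y0.
  apply: (measurable_fun_caratheodory (F := fun s y => f s (Num.max 0 y) u)) => //.
    by move=> y; apply: (aggregator_measurable fT); rewrite le_max lexx.
  move=> s sT; have Ys0 := Y0 s sT; rewrite max_r //.
  apply: cvg_trans (near_eq_cvg _) (aggregator_right_cvg_y sT Ys0).
  near=> z.
  rewrite max_r // (le_trans Ys0) // ltW //; near: z; exact: nbhs_right_gt.
apply: (measurable_fun_caratheodory (F := fun s u => f s (Y s) u)) => // s sT.
apply: cvg_at_right_filter; exact: (aggregator_continuous_u sT (Y0 s sT)).
Unshelve. all: by end_near.
Qed.

(** Difference quotients with a step to the right keep the argument in the
    half-line where [f] is measurable in [s]. *)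
Lemma measurable_partial_y (Y U : R -> R) : measurable_fun `[0, T] Y ->
  measurable_fun `[0, T] U -> (forall s, s \in `[0, T] -> 0 <= Y s) ->
  measurable_fun `[0, T] (fun s => partial_y f s (Y s) (U s)).
Proof.
move=> mY mU Y0; pose h n : R := n.+2%:R^-1.
have h0 n : 0 < h n by have /andP[] := harmonic2_itv n.
apply: (measurable_fun_cvg
  (h := fun n s => quotient_y f s (Y s) (U s) (Y s + h n))) => [n|s sT].
  rewrite /quotient_y.
  apply: (eq_measurable_fun
      (fun s => (f s (Y s + h n) (U s) - f s (Y s) (U s)) * (h n)^-1)).
    by move=> s _; rewrite [Y s + _]addrC addrK.
  apply: measurable_funM => //.
  apply: measurable_funB; apply: measurable_aggregator => //.
    exact: measurable_funD.
  by move=> s sT; rewrite addr_ge0 ?Y0 // ltW.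
apply: cvg_partial_y => //; first exact: Y0.
- by move=> n; rewrite addr_ge0 ?Y0 // ltW.
- by move=> n; rewrite -subr_eq0 addrAC subrr add0r gt_eqF.
- have c : Y s + h n @[n --> \oo] --> Y s + 0.
    by apply: cvgD; [exact: cvg_cst|exact: cvg_harmonic2].
  by rewrite addr0 in c; exact: c.
Qed.

Lemma measurable_partial_u (Y U : R -> R) : measurable_fun `[0, T] Y ->
  measurable_fun `[0, T] U -> (forall s, s \in `[0, T] -> 0 <= Y s) ->
  measurable_fun `[0, T] (fun s => partial_u f s (Y s) (U s)).
Proof.
move=> mY mU Y0; pose h n : R := n.+2%:R^-1.
have h0 n : 0 < h n by have /andP[] := harmonic2_itv n.
apply: (measurable_fun_cvg (h := fun n s =>
  (f s (Y s) (U s + h n) - f s (Y s) (U s)) / h n)) => [n|s sT].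
  apply: measurable_funM => //.
  apply: measurable_funB; apply: measurable_aggregator => //.
  exact: measurable_funD.
apply: cvg_partial_u => //; first exact: Y0.
  by move=> n; rewrite gt_eqF.
exact: cvg_harmonic2.
Qed.

Lemma aggregator_bounded B : exists G : R, forall s y, s \in `[0, T] -> 0 <= y ->
  y <= B -> `|f s y 0| <= G.
Proof.
have [al [K [/andP[al0 _] K0 fK]]] := aggregator_growth fT.
exists (K * (1 + B `^ al)) => s y sT y0 yB.
apply: le_trans (fK s y sT y0) _; rewrite ler_wpM2l ?(ltW K0) // lerD2l.
by rewrite ger0_norm // ge0_ler_powR // ?ltW // nnegrE (le_trans y0).
Qed.

End aggregator.

(** * Stieltjes measures and point masses *)

Section stieltjes.
Context {R : realType}.
Implicit Types (C : cumulative R R) (a b t : R).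

Lemma lebesgue_stieltjes_ocitv C a b : a <= b ->
  lebesgue_stieltjes_measure C `]a, b] = (C b - C a)%:E.
Proof.
move=> ab; rewrite /lebesgue_stieltjes_measure /measure_extension.
by rewrite measurable_mu_extE /= ?wlength_itv_bnd //; exact: is_ocitv.
Qed.

Lemma lebesgue_stieltjes_itvcc_lty C a b :
  (lebesgue_stieltjes_measure C `[a, b] < +oo)%E.
Proof.
have [ab|ba] := leP a b; last by rewrite set_itv_ge ?measure0 // bnd_simp -ltNge.
apply: (@le_lt_trans _ _ (lebesgue_stieltjes_measure C `]a - 1, b])).
  by apply: le_measure; rewrite ?inE //; apply: subset_itvr; rewrite bnd_simp; lra.
by rewrite lebesgue_stieltjes_ocitv ?ltry //; lra.
Qed.

(** The distribution function of [p * dC] plus the mass [q] at [t]. *)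
Definition add_mass (p q : {nonneg R}) t (C : R -> R) : R -> R :=
  fun x => p%:num * C x + q%:num * (t <= x)%R%:R.

Section add_mass.
Variables (p q : {nonneg R}) (t : R) (C : cumulative R R).

Let add_mass_nd : {homo add_mass p q t C : x y / x <= y}.
Proof.
move=> x y xy; apply: lerD; apply: ler_wpM2l => //.
  exact: cumulative_is_nondecreasing.
by rewrite ler_nat; case: (leP t x) => // tx; rewrite (le_trans tx xy).
Qed.

Let add_mass_rc : right_continuous (add_mass p q t C).
Proof.
move=> x; apply: cvgD; apply: cvgMl_tmp.
  exact: cumulative_is_right_continuous.
have [tx|xt] := leP t x; apply: cvg_trans (near_eq_cvg _) (cvg_cst _); near=> y.
  have xy : x < y by near: y; exact: nbhs_right_gt.
  by rewrite (le_trans tx (ltW xy)).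
have yt : y < t by near: y; exact: nbhs_right_lt.
by rewrite leNgt yt.
Unshelve. all: by end_near.
Qed.

HB.instance Definition _ :=
  isCumulative.Build R _ R (add_mass p q t C) add_mass_nd add_mass_rc.

Lemma lebesgue_stieltjes_add_mass (A : set R) : measurable A ->
  lebesgue_stieltjes_measure (add_mass p q t C) A =
  measure_add (mscale p (lebesgue_stieltjes_measure C))
    (mscale q (@dirac _ (measurableTypeR R) t R)) A.
Proof.
apply: lebesgue_stieltjes_measure_unique => _ [[a b] _ <-].
have [ab|ba] := leP a b; last by rewrite set_itv_ge ?measure0 // bnd_simp -leNgt ltW.
rewrite /= /msum 2!big_ord_recl big_ord0 adde0 /= /mscale /=.
rewrite lebesgue_stieltjes_ocitv // lebesgue_stieltjes_ocitv //= /add_mass diracE.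
rewrite -!EFinM -EFinD; congr EFin.
rewrite (_ : (t \in `]a, b]%classic)%:R = (t <= b)%R%:R - (t <= a)%R%:R :> R);
  first by ring.
rewrite mem_setE in_itv /= (ltNge a); case: (leP t a) => ta /=; last by rewrite subr0.
by rewrite (le_trans ta ab) subrr.
Qed.

Lemma ge0_integral_add_mass (D : set R) (g : R -> \bar R) : measurable D ->
  measurable_fun D g -> (forall x, D x -> (0 <= g x)%E) -> D t ->
  (\int[lebesgue_stieltjes_measure (add_mass p q t C)]_(x in D) g x =
   p%:num%:E * \int[lebesgue_stieltjes_measure C]_(x in D) g x
   + q%:num%:E * g t)%E.
Proof.
move=> mD mg g0 Dt.
rewrite (eq_measure_integral
  (measure_add (mscale p (lebesgue_stieltjes_measure C))
    (mscale q (@dirac _ (measurableTypeR R) t R)))); last first.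
  by move=> A mA _; exact: lebesgue_stieltjes_add_mass.
rewrite ge0_integral_measure_add // !ge0_integral_mscale //.
by rewrite integral_dirac // diracE mem_set // mul1e.
Qed.

End add_mass.
End stieltjes.

(** * Satisfaction and Tonelli's theorem *)

Section memory.
Context {R : realType}.
Variables (T : R) (eta : R -> R) (theta : R -> R -> R).
Hypothesis T0 : 0 < T.
Hypothesis eta_ge0 : forall t, t \in `[0, T] -> 0 <= eta t.
Hypothesis eta_continuous : {within `[0, T], continuous eta}.
Hypothesis theta_ge0 : forall t s, t \in `[0, T] -> s \in `[0, T] -> 0 <= theta t s.
Hypothesis theta_continuous : {within `[0, T] `*` `[0, T],
  continuous (fun p : R * R => theta p.1 p.2)}.
Notation mu := (@lebesgue_measure R).
Notation LS := lebesgue_stieltjes_measure.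
Implicit Types (C D : cumulative R R) (s t : R).

(** The weight [theta] is cut off outside the triangle [0 <= s <= t <= T] where
    it enters the model, so that integrals against it run over the whole line and
    can be exchanged. *)
Definition memory_kernel t s : R :=
  if (0 <= s) && (s <= t) && (t <= T) then theta t s else 0.

(** Composing [theta] with this retraction onto [[0, T]] gives a function that
    is continuous on the whole plane. *)
Definition clamp x : R := Num.max 0 (Num.min x T).

Lemma clamp_itv x : clamp x \in `[0, T].
Proof. by rewrite in_itv /= /clamp le_max lexx ge_max (ltW T0) ge_min lexx orbT. Qed.

Lemma clampE x : x \in `[0, T] -> clamp x = x.
Proof. by rewrite in_itv /= /clamp => /andP[x0 xT]; rewrite min_l // max_r. Qed.

Lemma clamp_continuous : continuous clamp.
Proof.
move=> x; apply: (@continuous_max _ _ (fun=> 0) (fun y => Num.min y T)).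
  exact: cvg_cst.
apply: (@continuous_min _ _ (fun y => y) (fun=> T)); first exact: cvg_id.
exact: cvg_cst.
Qed.

Lemma theta_clamp_continuous :
  continuous (fun p : R * R => theta (clamp p.1) (clamp p.2)).
Proof.
move=> p; move/subspace_continuousP : theta_continuous.
move=> /(_ (clamp p.1, clamp p.2) (conj (clamp_itv _) (clamp_itv _))) c.
have cc : (clamp q.1, clamp q.2) @[q --> p] --> within (`[0, T] `*` `[0, T])
    (nbhs (clamp p.1, clamp p.2)).
  apply: cvg_within_forall => [q|]; first by split; exact: clamp_itv.
  have c1 : clamp q.1 @[q --> p] --> clamp p.1.
    have f1 : q.1 @[q --> p] --> p.1 by exact: cvg_fst.
    exact: (cvg_comp _ _ f1 (@clamp_continuous p.1)).
  have c2 : clamp q.2 @[q --> p] --> clamp p.2.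
    have f2 : q.2 @[q --> p] --> p.2 by exact: cvg_snd.
    exact: (cvg_comp _ _ f2 (@clamp_continuous p.2)).
  exact: (cvg_pair c1 c2).
exact: cvg_comp cc c.
Qed.

Lemma theta_bounded : exists B, 0 <= B /\ forall t s, t \in `[0, T] ->
  s \in `[0, T] -> theta t s <= B.
Proof.
have cK : compact (`[0, T] `*` `[0, T] : set (R * R)).
  by apply: compact_setX; exact: segment_compact.
have [M [_ MP]] := compact_bounded (continuous_compact theta_continuous cK).
exists (`|M| + 1); split; first by rewrite addr_ge0.
move=> t s tT sT; apply: le_trans (ler_norm _) _.
apply: (MP (`|M| + 1)); first by rewrite (le_lt_trans (ler_norm _)) // ltrDl.
by exists (t, s).
Qed.

Lemma memory_kernelE t s : memory_kernel t s =
  if (0 <= s) && (s <= t) && (t <= T) then theta (clamp t) (clamp s) else 0.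
Proof.
rewrite /memory_kernel; case: ifP => // /andP[/andP[s0 st] tT].
by rewrite !clampE // in_itv /= ?s0 ?tT ?(le_trans s0 st) ?(le_trans st tT).
Qed.

Lemma memory_kernel_ge0 t s : 0 <= memory_kernel t s.
Proof. by rewrite memory_kernelE; case: ifP => // _; rewrite theta_ge0 // clamp_itv. Qed.

Lemma memory_kernel_in t s : t \in `[0, T] -> s \in `[0, t] ->
  memory_kernel t s = theta t s.
Proof.
by rewrite !in_itv /= /memory_kernel => /andP[_ ->] /andP[-> ->].
Qed.

Lemma memory_kernel_out t s : s \notin `[0, t] -> memory_kernel t s = 0.
Proof.
by rewrite in_itv /= /memory_kernel => /negbTE ->.
Qed.

Lemma memory_kernel_early t s : t \notin `[s, T] -> memory_kernel t s = 0.
Proof.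
by rewrite in_itv /= /memory_kernel -andbA => /negbTE ->; rewrite andbF.
Qed.

Lemma measurable_memory_kernel :
  measurable_fun setT (fun p : R * R => memory_kernel p.1 p.2).
Proof.
under eq_fun do rewrite memory_kernelE.
apply: measurable_fun_ifT.
  apply: measurable_and; last exact: measurable_fun_ler.
  by apply: measurable_and; exact: measurable_fun_ler.
- apply: (measurable_fun_caratheodory
    (F := fun (p : R * R) y => theta (clamp y) (clamp p.2))) => // [y|p _].
  have my : measurable_fun setT (fun s => theta (clamp y) (clamp s)).
    apply: continuous_measurable_fun => s.
    have c : (y, z) @[z --> s] --> (y, s).
      exact: (cvg_pair (cvg_cst y) (@cvg_id _ (nbhs s))).
    exact: (cvg_comp _ _ c (@theta_clamp_continuous (y, s))).
  exact: (measurableT_comp my measurable_snd).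
apply: cvg_at_right_filter.
have c : (z, p.2) @[z --> p.1] --> (p.1, p.2).
  exact: (cvg_pair (@cvg_id _ (nbhs p.1)) (cvg_cst p.2)).
exact: (cvg_comp _ _ c (@theta_clamp_continuous (p.1, p.2))).
- exact: measurable_cst.
Qed.

(** The excess of the satisfaction at time [t] over [eta t]; see
    [satisfactionE]. *)
Definition memory C t : \bar R := (\int[LS C]_s (memory_kernel t s)%:E)%E.

Lemma memory_ge0 C t : (0 <= memory C t)%E.
Proof. by apply: integral_ge0 => s _; rewrite lee_fin memory_kernel_ge0. Qed.

Lemma measurable_memory_kernel_r t : measurable_fun setT (memory_kernel t).
Proof. exact: (measurable_fun_pair2 t measurable_memory_kernel). Qed.

Lemma memory_bounded C : exists B : R, forall t, (memory C t <= B%:E)%E.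
Proof.
have [B [B0 thetaB]] := theta_bounded.
exists (B * fine (LS C `[0, T])) => t.
have fC : LS C `[0, T] \is a fin_num.
  by rewrite ge0_fin_numE // lebesgue_stieltjes_itvcc_lty.
rewrite EFinM fineK // -integral_cst //.
rewrite /memory [leRHS]integral_mkcond; apply: ge0_le_integral => //.
- by move=> s _; rewrite lee_fin memory_kernel_ge0.
- by apply/measurable_EFinP; exact: measurable_memory_kernel_r.
- by apply/(measurable_restrictT _ _).1 => //; exact: measurable_cst.
- move=> s _; rewrite patchE; case: ifPn => sT.
    rewrite memory_kernelE lee_fin; case: ifP => // _.
    by apply: thetaB; exact: clamp_itv.
  rewrite /memory_kernel; case: ifP => // /andP[/andP[s0 st] tT].
  by rewrite mem_setE in_itv /= s0 (le_trans st tT) in sT.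
Qed.

Lemma memory_fin_num C t : memory C t \is a fin_num.
Proof.
have [B CB] := memory_bounded C.
rewrite ge0_fin_numE; last exact: memory_ge0.
by apply: le_lt_trans (CB t) _; exact: ltry.
Qed.

Lemma measurable_memory C : measurable_fun setT (memory C).
Proof.
apply: (measurable_fun_fubini_tonelli_F (m2 := LS C)
  (fun p : R * R => (memory_kernel p.1 p.2)%:E)).
  by apply/measurable_EFinP; exact: measurable_memory_kernel.
by move=> p; rewrite lee_fin memory_kernel_ge0.
Qed.

Lemma measurable_fine_memory C : measurable_fun `[0, T] (fun t => fine (memory C t)).
Proof.
apply: measurable_funTS; apply: measurableT_comp (measurable_memory C).
exact: fine_measurable.
Qed.

Lemma satisfactionE C t : t \in `[0, T] ->
  satisfaction eta theta C t = eta t + fine (memory C t).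
Proof.
move=> tT; rewrite /satisfaction /Rintegral; congr (_ + fine _).
rewrite integral_mkcond; apply: eq_integral => s _; rewrite patchE mem_setE.
by case: ifPn => st; [rewrite memory_kernel_in|rewrite memory_kernel_out].
Qed.

Lemma satisfaction_ge_eta C t : t \in `[0, T] ->
  eta t <= satisfaction eta theta C t.
Proof. by move=> tT; rewrite satisfactionE // lerDl fine_ge0 ?memory_ge0. Qed.

Lemma satisfaction_ge0 C t : t \in `[0, T] -> 0 <= satisfaction eta theta C t.
Proof. by move=> tT; rewrite (le_trans (eta_ge0 tT)) ?satisfaction_ge_eta. Qed.

Lemma measurable_satisfaction C :
  measurable_fun `[0, T] (satisfaction eta theta C).
Proof.
apply: (eq_measurable_fun (fun t => eta t + fine (memory C t))).
  by move=> t; rewrite inE => tT; rewrite satisfactionE.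
apply: measurable_funD; last exact: measurable_fine_memory.
exact: subspace_continuous_measurable_fun.
Qed.

Lemma satisfaction_bounded C : exists B : R, forall t, t \in `[0, T] ->
  satisfaction eta theta C t <= B.
Proof.
have [B CB] := memory_bounded C.
have [M [_ MP]] := compact_bounded
  (continuous_compact eta_continuous (@segment_compact _ 0 T)).
exists (`|M| + 1 + B) => t tT; rewrite satisfactionE //; apply: lerD.
  apply: le_trans (ler_norm _) _.
  apply: (MP (`|M| + 1)); first by rewrite (le_lt_trans (ler_norm _)) // ltrDl.
  by exists t.
by rewrite -lee_fin fineK // memory_fin_num.
Qed.

Lemma memory_add_mass (p q : {nonneg R}) C s t :
  (memory (add_mass p q s C) t =
   p%:num%:E * memory C t + (q%:num * memory_kernel t s)%:E)%E.
Proof.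
rewrite /memory ge0_integral_add_mass ?EFinM //.
  by apply/measurable_EFinP; exact: measurable_memory_kernel_r.
by move=> x _; rewrite lee_fin memory_kernel_ge0.
Qed.

(** The effect of a unit mass at time [t] on the later satisfactions, weighted
    by [p].  For [p] the marginal utility of satisfaction, this is the utility
    gradient. *)
Definition later_effect (p : R -> R) t : \bar R :=
  (\int[mu]_(s in `[t, T]) (p s * theta s t)%:E)%E.

Lemma later_effectE p t : t \in `[0, T] -> later_effect p t =
  (\int[mu]_(s in `[0%R, T]) (p s * memory_kernel s t)%:E)%E.
Proof.
move=> tT; have := tT; rewrite in_itv /= => /andP[t0 _].
rewrite /later_effect integral_mkcond [RHS]integral_mkcond.
apply: eq_integral => s _; rewrite !patchE !mem_setE; case: ifPn => st; last first.
  by case: ifPn => // _; rewrite memory_kernel_early // mulr0.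
have := st; rewrite in_itv /= => /andP[ts sT].
have sT' : s \in `[0, T] by rewrite in_itv /= sT (le_trans t0).
by rewrite sT' memory_kernel_in // in_itv /= t0.
Qed.

Section later_effect.
Variable p : R -> R.
Hypothesis mp : measurable_fun `[0, T] p.
Hypothesis p0 : forall s, s \in `[0, T] -> 0 <= p s.

Let F (st : R * R) : \bar R :=
  ((p \_ `[0%R, T]%classic) st.1 * memory_kernel st.1 st.2)%:E.

Let F0 st : (0 <= F st)%E.
Proof.
rewrite lee_fin mulr_ge0 ?memory_kernel_ge0 // patchE.
by case: ifPn => //; rewrite mem_setE; exact: p0.
Qed.

Let mF : measurable_fun setT F.
Proof.
apply/measurable_EFinP; apply: measurable_funM; last exact: measurable_memory_kernel.
have mpT : measurable_fun setT (p \_ `[0%R, T]%classic).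
  exact/(measurable_restrictT _ _).1.
exact: (measurableT_comp mpT measurable_fst).
Qed.

Let later_effectF t : t \in `[0, T] -> later_effect p t = (\int[mu]_s F (s, t))%E.
Proof.
move=> tT; rewrite later_effectE // integral_mkcond; apply: eq_integral => s _.
by rewrite /F /= !patchE; case: ifPn; rewrite ?mul0r.
Qed.

Lemma measurable_later_effect : measurable_fun `[0, T] (later_effect p).
Proof.
apply: (eq_measurable_fun (fun t => \int[mu]_s F (s, t))%E).
  by move=> t; rewrite inE => tT; rewrite later_effectF.
by apply: measurable_funTS; exact: measurable_fun_fubini_tonelli_G.
Qed.

Lemma later_effect_ge0 t : t \in `[0, T] -> (0 <= later_effect p t)%E.
Proof. by move=> tT; rewrite later_effectF //; apply: integral_ge0 => s _; exact: F0. Qed.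

(** Tonelli's theorem on the triangle: the total effect of a plan is the same
    summed over the times of consumption and over the times of satisfaction. *)
Lemma integral_later_effect C :
  (\int[LS C]_(t in `[0%R, T]) later_effect p t =
   \int[mu]_(s in `[0%R, T]) ((p s)%:E * memory C s))%E.
Proof.
transitivity (\int[LS C]_t \int[mu]_s F (s, t))%E.
  rewrite integral_mkcond; apply: eq_integral => t _.
  rewrite patchE mem_setE; case: ifPn => tT; first exact: later_effectF.
  rewrite integral0_eq // => s _; rewrite /F /= /memory_kernel.
  case: ifP => [/andP[/andP[t0 ts] sT]|]; last by rewrite mulr0.
  by rewrite in_itv /= t0 (le_trans ts sT) in tT.
have tonelli : (\int[mu]_s \int[LS C]_t F (s, t) =
    \int[LS C]_t \int[mu]_s F (s, t))%E.
  by apply: fubini_tonelli; [exact: mF|exact: F0].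
rewrite -tonelli.
rewrite [RHS]integral_mkcond; apply: eq_integral => s _.
rewrite /F /= !patchE mem_setE; case: ifPn => sT; last first.
  by under eq_integral do rewrite mul0r; rewrite integral0.
under eq_integral do rewrite EFinM.
have mk : measurable_fun setT (fun t => (memory_kernel s t)%:E).
  by apply/measurable_EFinP; exact: measurable_memory_kernel_r.
have ps0 : (0 <= (p s)%:E)%E by rewrite lee_fin p0.
apply: ge0_integralZl; [exact: measurableT|exact: mk| |exact: ps0].
by move=> t _; rewrite lee_fin memory_kernel_ge0.
Qed.

End later_effect.

End memory.

(** * Recursive utility and its tangent *)

Section utility.
Context {R : realType}.
Variables (T : R) (eta : R -> R) (theta : R -> R -> R) (f : R -> R -> R -> R).
Hypothesis T0 : 0 < T.
Hypothesis eta_ge0 : forall t, t \in `[0, T] -> 0 <= eta t.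
Hypothesis eta_continuous : {within `[0, T], continuous eta}.
Hypothesis theta_ge0 : forall t s, t \in `[0, T] -> s \in `[0, T] -> 0 <= theta t s.
Hypothesis theta_continuous : {within `[0, T] `*` `[0, T],
  continuous (fun p : R * R => theta p.1 p.2)}.
Hypothesis fT : aggregator_assumptions T f.
Notation mu := (@lebesgue_measure R).
Notation LS := lebesgue_stieltjes_measure.
Notation Y := (satisfaction eta theta).
Notation U := (recursive_utility T f eta theta).
Notation mem := (memory T theta).
Implicit Types (C D : cumulative R R) (s t : R).

Let mY C : measurable_fun `[0, T] (Y C).
Proof. exact: measurable_satisfaction. Qed.

Let Y0 C s : s \in `[0, T] -> 0 <= Y C s.
Proof. exact: satisfaction_ge0. Qed.

Let Ybnd C : exists B : R, forall s, s \in `[0, T] -> Y C s <= B.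
Proof. exact: satisfaction_bounded. Qed.

Lemma recursive_utilityP C : is_recursive_utility T f (Y C) (U C).
Proof.
apply: xgetPex.
have [K [K0 fK]] := aggregator_lipschitz fT.
have [B YB] := Ybnd C.
have [G fG] := aggregator_bounded fT B.
apply: (@backward_equation_solvable _ 0 T (fun s u => f s (Y C s) u) G K).
- exact: ltW.
- by [].
- move=> V mV; apply: (measurable_aggregator fT) => //; exact: Y0.
- by move=> s u u' sT; apply: fK => //; exact: Y0.
- by move=> s sT; apply: fG => //; [exact: Y0|exact: YB].
Qed.

(** A bound for the utility that depends on the plan only through a bound for
    its satisfaction, hence is uniform along the plans compared below. *)
Lemma recursive_utility_bounded B : exists W : R, forall C,
  (forall s, s \in `[0, T] -> Y C s <= B) ->
  measurable_fun `[0, T] (U C) /\ forall s, s \in `[0, T] -> `|U C s| <= W.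
Proof.
have [K [K0 fK]] := aggregator_lipschitz fT.
have [G fG] := aggregator_bounded fT B.
exists (`|G| * T * expR (K * T)) => C YB.
have [intf UE] := recursive_utilityP C.
have mT : measurable (`[0, T]%classic : set R) by exact: measurable_itv.
have intG : mu.-integrable `[0, T] (EFin \o (fun=> `|G|)).
  by apply: (itvcc_integrable (B := `|G|)) => // s _; rewrite normr_id.
have fle s : s \in `[0, T] -> `|f s (Y C s) (U C s)| <= `|G| + K * `|U C s|.
  move=> sT; have Ys := Y0 C sT.
  rewrite -[f s (Y C s) (U C s)](subrK (f s (Y C s) 0)) addrC.
  apply: le_trans (ler_normD _ _) _; apply: lerD.
    exact: le_trans (fG s _ sT Ys (YB s sT)) (ler_norm _).
  by have := fK s (Y C s) (U C s) 0 sT Ys; rewrite subr0.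
have [mU Ule] := backward_stability (ltW T0) (ltW K0) intf intG
  (fun _ _ => normr_ge0 G) UE fle.
split=> // s sT; apply: le_trans (Ule s sT) _.
rewrite Rintegral_cst // lebesgue_itvcc ?(ltW T0) // subr0.
move: sT; rewrite in_itv /= => /andP[s0 _].
by rewrite ler_wpM2l ?mulr_ge0 ?(ltW T0) // ler_expR ler_wpM2l ?(ltW K0) // gerBl.
Qed.

Lemma measurable_recursive_utility C : measurable_fun `[0, T] (U C).
Proof. by have [B YB] := Ybnd C; have [W /(_ C YB)[]] := recursive_utility_bounded B. Qed.

(** The gradient of the utility with respect to the satisfaction at time [s]:
    the discount factor from 0 to [s] times the derivative of [f] in [y]. *)
Definition marginal_utility C s : R :=
  expR (\int[mu]_(v in `[0, s]) partial_u f v (Y C v) (U C v))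
  * partial_y f s (Y C s) (U C s).

Lemma aggregate_bounded B : exists G : R, forall C,
  (forall s, s \in `[0, T] -> Y C s <= B) ->
  forall s y, s \in `[0, T] -> 0 <= y -> y <= B -> `|f s y (U C s)| <= G.
Proof.
have [K [K0 fK]] := aggregator_lipschitz fT.
have [G fG] := aggregator_bounded fT B.
have [W UW] := recursive_utility_bounded B.
exists (G + K * W) => C YB s y sT y0 yB; have [_ /(_ s sT) Us] := UW C YB.
rewrite -[f s y (U C s)](subrK (f s y 0)) addrC.
apply: le_trans (ler_normD _ _) _; apply: lerD; first exact: fG.
apply: le_trans (fK s y (U C s) 0 sT y0) _.
by rewrite subr0 ler_wpM2l // ltW.
Qed.

Let mU := measurable_recursive_utility.

Let intpu C : mu.-integrable `[0, T] (EFin \o (fun v => partial_u f v (Y C v) (U C v))).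
Proof.
have [K [K0 fK]] := aggregator_lipschitz fT.
apply: (itvcc_integrable (B := K)).
  exact: (measurable_partial_u fT (mY C) (mU C) (@Y0 C)).
by move=> s sT; exact: (partial_u_bounded fT _ fK sT (Y0 C sT)).
Qed.

Lemma measurable_marginal_utility C : measurable_fun `[0, T] (marginal_utility C).
Proof.
apply: measurable_funM; last first.
  exact: (measurable_partial_y fT (mY C) (mU C) (@Y0 C)).
exact: measurable_expR_primitive (ltW T0) (intpu C).
Qed.

Lemma marginal_utility_gt0 C s : s \in `[0, T] -> 0 < marginal_utility C s.
Proof.
by move=> sT; rewrite mulr_gt0 ?expR_gt0 // (partial_y_gt0 fT) // Y0.
Qed.

Lemma discount_bounded K C s : 0 <= K ->
  (forall s y u u', s \in `[0, T] -> 0 <= y ->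
     `|f s y u - f s y u'| <= K * `|u - u'|) -> s \in `[0, T] ->
  `|\int[mu]_(v in `[0, s]) partial_u f v (Y C v) (U C v)| <= K * T.
Proof.
move=> K0 fK; rewrite in_itv /= => /andP[s0 sT].
apply: (@le_trans _ _ (K * (s - 0))); last by rewrite subr0 ler_wpM2l.
apply: norm_Rintegral_itvcc => //.
  apply: (measurable_fun_subitv (lexx 0) sT).
  exact: (measurable_partial_u fT (mY C) (mU C) (@Y0 C)).
move=> v vs; have vT := subitvcc (lexx 0) sT vs.
exact: (partial_u_bounded fT _ fK vT (Y0 C vT)).
Qed.

(** By concavity, [y] times the derivative of [f] at [y] is at most the increment of
    [f] between 0 and [y], although the derivative alone may be unbounded near
    [y = 0].  The bound is uniform over plans with the same bound for the
    satisfaction. *)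
Lemma marginal_utility_bounded B : exists W : R, forall C,
  (forall s, s \in `[0, T] -> Y C s <= B) ->
  forall s, s \in `[0, T] -> marginal_utility C s * Y C s <= W.
Proof.
have [K [K0 fK]] := aggregator_lipschitz fT.
have [G fG] := aggregate_bounded B.
exists (expR (K * T) * (2 * G)) => C YB s sT.
have Ys := Y0 C sT; rewrite -mulrA ler_pM ?expR_ge0 //.
- by rewrite mulr_ge0 // ltW // (partial_y_gt0 fT).
- rewrite ler_expR; apply: le_trans (ler_norm _) _.
  exact: discount_bounded (ltW K0) fK sT.
have := aggregator_tangent_y fT (U C s) sT Ys (lexx 0).
have := fG C YB s _ sT Ys (YB s sT).
have := fG C YB s 0 sT (lexx 0) (le_trans Ys (YB s sT)).
by rewrite !ler_norml sub0r => /andP[h1 h2] /andP[h3 h4] h5; lra.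
Qed.

Lemma marginal_memory_integrable C D (c : R) :
  (forall s, s \in `[0, T] -> fine (mem C s) <= c * Y D s) ->
  mu.-integrable `[0, T]
    (EFin \o (fun s => marginal_utility D s * fine (mem C s))).
Proof.
move=> memY; have [B YB] := Ybnd D.
have [W pW] := marginal_utility_bounded B.
apply: (itvcc_integrable (B := `|c| * W)).
  apply: measurable_funM; first exact: measurable_marginal_utility.
  exact: measurable_fine_memory.
move=> s sT; have p0 := ltW (marginal_utility_gt0 D sT).
have m0 : 0 <= fine (mem C s) by rewrite fine_ge0 // memory_ge0.
rewrite ger0_norm; last exact: mulr_ge0 p0 m0.
apply: (@le_trans _ _ (marginal_utility D s * (`|c| * Y D s))).
  rewrite ler_wpM2l //; apply: le_trans (memY s sT) _.
  by rewrite ler_wpM2r ?Y0 // ler_norm.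
rewrite mulrCA; apply: ler_wpM2l => //; exact: (pW D YB s sT).
Qed.

Lemma marginal_own_memory_integrable C : mu.-integrable `[0, T]
  (EFin \o (fun s => marginal_utility C s * fine (mem C s))).
Proof.
apply: (marginal_memory_integrable (c := 1)) => s sT.
by rewrite mul1r (satisfactionE eta theta C sT) lerDr eta_ge0.
Qed.

(** Variation of constants for the difference of two utilities, with the
    derivative in [u] along [C] as rate; the tangent plane of [f] at the values
    along [C] bounds what remains. *)
Let utility_difference C D : exists phi : R -> R,
  [/\ mu.-integrable `[0, T] (EFin \o phi),
    U D 0 - U C 0 = \int[mu]_(s in `[0, T]) phi s &
    forall s, s \in `[0, T] -> phi s <= marginal_utility C s * (Y D s - Y C s)].
Proof.
have [K [K0 fK]] := aggregator_lipschitz fT.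
have mT : measurable (`[0, T]%classic : set R) by exact: measurable_itv.
pose E s := expR (\int[mu]_(v in `[0, s]) partial_u f v (Y C v) (U C v)).
pose pu s := partial_u f s (Y C s) (U C s).
pose g s := f s (Y D s) (U D s) - f s (Y C s) (U C s).
pose h s := U D s - U C s.
have [iD UD] := recursive_utilityP D; have [iC UC] := recursive_utilityP C.
have mg : measurable_fun `[0, T] g.
  exact: (measurable_funB (measurable_aggregator fT (mY D) (mU D) (@Y0 D))
    (measurable_aggregator fT (mY C) (mU C) (@Y0 C))).
have mh : measurable_fun `[0, T] h by exact: measurable_funB.
have mpu : measurable_fun `[0, T] pu.
  exact: (measurable_partial_u fT (mY C) (mU C) (@Y0 C)).
have [BC YC] := Ybnd C; have [BD YD] := Ybnd D.
have [GC fGC] := aggregate_bounded BC; have [GD fGD] := aggregate_bounded BD.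
have gG s : s \in `[0, T] -> `|g s| <= GD + GC.
  move=> sT; apply: le_trans (ler_normB _ _) _.
  apply: lerD; first exact: (fGD D YD s _ sT (Y0 D sT) (YD s sT)).
  exact: (fGC C YC s _ sT (Y0 C sT) (YC s sT)).
have [WC /(_ C YC)[_ UWC]] := recursive_utility_bounded BC.
have [WD /(_ D YD)[_ UWD]] := recursive_utility_bounded BD.
have hH s : s \in `[0, T] -> `|h s| <= WD + WC.
  move=> sT; apply: le_trans (ler_normB _ _) _.
  exact: lerD (UWD s sT) (UWC s sT).
have puK s : s \in `[0, T] -> `|pu s| <= K.
  by move=> sT; exact: (partial_u_bounded fT _ fK sT (Y0 C sT)).
have hE t : t \in `[0, T] -> h t = \int[mu]_(s in `[t, T]) g s.
  move=> tT; have := tT; rewrite in_itv /= => /andP[t0 _].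
  rewrite /h UD // UC //.
  have mtT : measurable (`[t, T]%classic : set R) by exact: measurable_itv.
  by rewrite (RintegralB (mu := mu) mtT (integrable_subitv t0 (lexx T) iD)
    (integrable_subitv t0 (lexx T) iC)).
pose phi s := E s * (g s - pu s * h s).
have h0 : U D 0 - U C 0 = \int[mu]_(s in `[0, T]) phi s.
  exact: (backward_variation_of_constants (ltW T0) mpu puK mg gG hE).
have mphi : measurable_fun `[0, T] phi.
  apply: measurable_funM; first exact: measurable_expR_primitive (ltW T0) (intpu C).
  exact: (measurable_funB mg (measurable_funM mpu mh)).
have intphi : mu.-integrable `[0, T] (EFin \o phi).
  apply: (itvcc_integrable (B := expR (K * T) * (GD + GC + K * (WD + WC))) mphi).
  move=> s sT; rewrite normrM ler_pM //.
    rewrite ger0_norm ?expR_ge0 // ler_expR; apply: le_trans (ler_norm _) _.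
    exact: discount_bounded (ltW K0) fK sT.
  apply: le_trans (ler_normB _ _) _; apply: lerD; first exact: gG.
  by rewrite normrM ler_pM // ?puK // hH.
exists phi; split => // s sT; rewrite -[leRHS]mulrA ler_wpM2l ?expR_ge0 // lerBlDr.
exact: (aggregator_tangent fT (U C s) (U D s) sT (Y0 C sT) (Y0 D sT)).
Qed.

Lemma integral_marginal_memory C D :
  (\int[mu]_(s in `[0%R, T]) ((marginal_utility C s)%:E * mem D s) =
   \int[mu]_(s in `[0%R, T]) (marginal_utility C s * fine (mem D s))%:E)%E.
Proof.
apply: eq_integral => s _; have fm : mem D s \is a fin_num by exact: memory_fin_num.
exact: (congr1 (fun z => (marginal_utility C s)%:E * z)%E (esym (fineK fm))).
Qed.

(** The tangent inequality for the utility as a function of the plan.  The sum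
    form keeps its meaning when the right-hand side is infinite; the integral on
    the left is always finite. *)
Lemma utility_variation C D :
  ((U D 0 - U C 0)%:E
   + \int[mu]_(s in `[0%R, T]) ((marginal_utility C s)%:E * mem C s)
   <= \int[mu]_(s in `[0%R, T]) ((marginal_utility C s)%:E * mem D s))%E.
Proof.
have mT : measurable (`[0, T]%classic : set R) by exact: measurable_itv.
have [phi [intphi -> phile]] := utility_difference C D.
rewrite [X in (_ + X)%E](integral_marginal_memory C C).
rewrite [leRHS](integral_marginal_memory C D).
have mD0 D' s : 0 <= fine (mem D' s) by apply: fine_ge0; exact: memory_ge0.
have intC : mu.-integrable `[0, T]
    (EFin \o (fun s => marginal_utility C s * fine (mem C s))).
  exact: marginal_own_memory_integrable.
have phile' s : s \in `[0, T] -> phi s + marginal_utility C s * fine (mem C s)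
    <= marginal_utility C s * fine (mem D s).
  move=> sT; rewrite -lerBrDr -mulrBr; apply: le_trans (phile s sT) _.
  rewrite (satisfactionE eta theta C sT) (satisfactionE eta theta D sT).
  by rewrite opprD addrACA subrr add0r.
rewrite /Rintegral fineK; last exact: (integrable_fin_num (mu := mu) mT intphi).
rewrite -(integralD_EFin (mu := mu) mT intphi intC).
have [->|Dfin] := eqVneq (\int[mu]_(s in `[0%R, T])
    (marginal_utility C s * fine (mem D s))%:E)%E +oo%E; first by rewrite leey.
have intD : mu.-integrable `[0, T]
    (EFin \o (fun s => marginal_utility C s * fine (mem D s))).
  apply/integrableP; split.
    apply/measurable_EFinP; apply: measurable_funM; last exact: measurable_fine_memory.
    exact: measurable_marginal_utility.
  apply: (@le_lt_trans _ _ (\int[mu]_(s in `[0%R, T])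
    (marginal_utility C s * fine (mem D s))%:E)%E); last by rewrite lt_neqAle Dfin leey.
  rewrite le_eqVlt; apply/orP; left; apply/eqP; apply: eq_integral => s.
  rewrite inE => sT /=; rewrite ger0_norm //.
  exact: mulr_ge0 (ltW (marginal_utility_gt0 C sT)) (mD0 D s).
have intphiC := integrableD (mu := mu) mT intphi intC.
apply: (le_integral (mu := mu) mT intphiC intD) => s; rewrite inE => sT.
by rewrite /= -EFinD lee_fin; exact: phile'.
Qed.

End utility.

(** * First-order condition at an optimal plan *)

Section first_order.
Context {R : realType}.
Variables (T : R) (eta : R -> R) (theta : R -> R -> R) (f : R -> R -> R -> R).
Hypothesis T0 : 0 < T.
Hypothesis eta_ge0 : forall t, t \in `[0, T] -> 0 <= eta t.
Hypothesis eta_continuous : {within `[0, T], continuous eta}.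
Hypothesis theta_ge0 : forall t s, t \in `[0, T] -> s \in `[0, T] -> 0 <= theta t s.
Hypothesis theta_continuous : {within `[0, T] `*` `[0, T],
  continuous (fun p : R * R => theta p.1 p.2)}.
Hypothesis fT : aggregator_assumptions T f.
Notation mu := (@lebesgue_measure R).
Notation LS := lebesgue_stieltjes_measure.
Notation Y := (satisfaction eta theta).
Notation U := (recursive_utility T f eta theta).
Notation mem := (memory T theta).
Notation p_ := (marginal_utility T eta theta f).
Implicit Types (C D : cumulative R R) (s t : R).

Let mY C : measurable_fun `[0, T] (Y C).
Proof. exact: measurable_satisfaction. Qed.

Let Y0 C s : s \in `[0, T] -> 0 <= Y C s.
Proof. exact: satisfaction_ge0. Qed.

Let mU C : measurable_fun `[0, T] (U C).
Proof. exact: measurable_recursive_utility. Qed.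

Section continuity.
Variables (C_ : nat -> cumulative R R) (C : cumulative R R) (B : R).
Hypothesis YB_ : forall n s, s \in `[0, T] -> Y (C_ n) s <= B.
Hypothesis YB : forall s, s \in `[0, T] -> Y C s <= B.
Hypothesis cvgY : forall s, s \in `[0, T] -> Y (C_ n) s @[n --> \oo] --> Y C s.

(** The utilities differ by at most a multiple of the integral of the difference
    of the aggregators at the same utility, which tends to 0 by bounded
    convergence. *)
Lemma recursive_utility_cvg s : s \in `[0, T] -> U (C_ n) s @[n --> \oo] --> U C s.
Proof.
move=> sT; have [K [K0 fK]] := aggregator_lipschitz fT.
have mT : measurable (`[0, T]%classic : set R) by exact: measurable_itv.
have [G fG] := aggregate_bounded T0 eta_ge0 eta_continuous theta_ge0
  theta_continuous fT B.
pose d n r := `|f r (Y (C_ n) r) (U C r) - f r (Y C r) (U C r)|.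
have dG n r : r \in `[0, T] -> `|d n r| <= G + G.
  move=> rT; rewrite /d normr_id; apply: le_trans (ler_normB _ _) _.
  exact: lerD (fG C YB r _ rT (Y0 (C_ n) rT) (YB_ n rT))
    (fG C YB r _ rT (Y0 C rT) (YB rT)).
have md n : measurable_fun `[0, T] (d n).
  apply: measurableT_comp => //.
  exact: (measurable_funB (measurable_aggregator fT (mY (C_ n)) (mU C) (@Y0 (C_ n)))
    (measurable_aggregator fT (mY C) (mU C) (@Y0 C))).
have cvgd : \int[mu]_(r in `[0, T]) d n r @[n --> \oo] --> \int[mu]_(r in `[0, T]) 0.
  apply: (bounded_convergence (m := mu) mT (lebesgue_itvcc_lty 0 T) md dG) => r rT.
  apply/norm_cvg0P; apply/subr_cvg0.
  exact: (aggregator_cvg_y fT rT (Y0 C rT) (fun n => Y0 (C_ n) rT) (cvgY rT)).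
have stable n : `|U (C_ n) s - U C s| <=
    (\int[mu]_(r in `[0, T]) d n r) * expR (K * (T - s)).
  have [iU UE] := recursive_utilityP T0 eta_ge0 eta_continuous theta_ge0
    theta_continuous fT C.
  have [i_ U_E] := recursive_utilityP T0 eta_ge0 eta_continuous theta_ge0
    theta_continuous fT (C_ n).
  pose g r := f r (Y (C_ n) r) (U (C_ n) r) - f r (Y C r) (U C r).
  have ig := integrable_subr (m := mu) mT i_ iU.
  have id := itvcc_integrable (md n) (dG n).
  have d0 r : r \in `[0, T] -> 0 <= d n r by rewrite normr_ge0.
  have hE t : t \in `[0, T] -> U (C_ n) t - U C t = \int[mu]_(r in `[t, T]) g r.
    move=> tT; have := tT; rewrite in_itv /= => /andP[t0 _].
    have mtT : measurable (`[t, T]%classic : set R) by exact: measurable_itv.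
    rewrite U_E // UE //.
    by rewrite (RintegralB (mu := mu) mtT (integrable_subitv t0 (lexx T) i_)
      (integrable_subitv t0 (lexx T) iU)).
  have gd r : r \in `[0, T] -> `|g r| <= d n r + K * `|U (C_ n) r - U C r|.
    move=> rT; apply: le_trans (lerD (lexx _) (fK _ _ _ _ rT (Y0 (C_ n) rT))).
    by rewrite [leRHS]addrC; exact: (ler_distD (f r (Y (C_ n) r) (U C r))).
  by have [_] := backward_stability (ltW T0) (ltW K0) ig id d0 hE gd; exact.
apply: (cvg_dist_le stable).
have z : (\int[mu]_(r in `[0, T]) (0:R)) = 0 by rewrite Rintegral_cst // mul0r.
rewrite z in cvgd.
by have := cvgMr_tmp (b := expR (K * (T - s))) cvgd; rewrite mul0r; exact.
Qed.

Lemma marginal_utility_cvg s : s \in `[0, T] -> p_ (C_ n) s @[n --> \oo] --> p_ C s.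
Proof.
move=> sT; have := sT; rewrite in_itv /= => /andP[s0 sT'].
have [K [K0 fK]] := aggregator_lipschitz fT.
apply: cvgM; last first.
  exact: (cvg_partial_y_joint fT sT (Y0 C sT) (fun n => Y0 (C_ n) sT) (cvgY sT)
    (recursive_utility_cvg sT)).
have ms : measurable (`[0, s]%classic : set R) by exact: measurable_itv.
have c : \int[mu]_(v in `[0, s]) partial_u f v (Y (C_ n) v) (U (C_ n) v) @[n --> \oo]
    --> \int[mu]_(v in `[0, s]) partial_u f v (Y C v) (U C v).
  apply: (bounded_convergence (m := mu) (B := K) ms (lebesgue_itvcc_lty 0 s)).
  - move=> n; apply: (measurable_fun_subitv (lexx 0) sT').
    exact: (measurable_partial_u fT (mY (C_ n)) (mU (C_ n)) (@Y0 (C_ n))).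
  - move=> n v vs; have vT := subitvcc (lexx 0) sT' vs.
    exact: (partial_u_bounded fT _ fK vT (Y0 (C_ n) vT)).
  - move=> v vs; have vT := subitvcc (lexx 0) sT' vs.
    exact: (cvg_partial_u_joint fT vT (Y0 C vT) (fun n => Y0 (C_ n) vT) (cvgY vT)
      (recursive_utility_cvg vT)).
exact: (cvg_comp _ _ c (@continuous_expR R _)).
Qed.

End continuity.

Lemma memory_kernel_bounded : exists B : R, 0 <= B /\
  forall s t, memory_kernel T theta s t <= B.
Proof.
have [B [B0 thetaB]] := theta_bounded theta_continuous.
exists B; split => // s t; rewrite memory_kernelE //; case: ifP => // _.
by apply: thetaB; exact: clamp_itv.
Qed.

(** The arithmetic of a perturbation by the share [l]: after cancelling
    [(1 - l) * x], the inequality is divided by [l]; it also excludes that [z] is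
    infinite. *)
Lemma share_le (l d x : R) (z : \bar R) : 0 < l -> 0 <= d -> (0 <= z)%E ->
  (d%:E + ((1 - l)%:E * x%:E + l%:E * z) <= x%:E)%E -> (z <= x%:E)%E.
Proof.
move=> l0 d0; case: z => [z||] //=.
  rewrite -EFinM -!EFinD !lee_fin => z0 h; rewrite -(ler_pM2l l0); lra.
by rewrite gt0_muley ?lte_fin // !addey.
Qed.

(** The plan [C] is perturbed by moving a small share of it to a mass at [t0].
    The tangent at the perturbed plan, evaluated at [C], gives the inequality
    with the marginal utility of the perturbed plan, whose integral against the
    memory of [C] is finite and uniformly bounded because the perturbed
    satisfaction is at least half that memory.  In the limit, Fatou's lemma
    handles the mass, and bounded convergence the memory of [C]. *)
Lemma first_order_condition C t0 (k : R) : t0 \in `[0, T] -> 0 <= k ->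
  (forall p q : {nonneg R}, p%:num <= 1 -> q%:num = k * (1 - p%:num) ->
     U (add_mass p q t0 C) 0 <= U C 0) ->
  (\int[mu]_(s in `[0%R, T]) (k * (p_ C s * memory_kernel T theta s t0))%:E
   <= (\int[mu]_(s in `[0%R, T]) (p_ C s * fine (mem C s)))%:E)%E.
Proof.
move=> t0T k0 opt.
have mT : measurable (`[0, T]%classic : set R) by exact: measurable_itv.
pose l n : R := n.+2%:R^-1.
have l0 n : 0 < l n by have /andP[] := harmonic2_itv R n.
have l1 n : l n <= 2^-1 by rewrite lef_pV2 ?posrE ?ltr0n // ler_nat.
have l10 n : 0 <= 1 - l n by have := l1 n; lra.
have kl0 n : 0 <= k * l n by rewrite mulr_ge0 // ltW.
pose C_ n : cumulative R R := add_mass (NngNum (l10 n)) (NngNum (kl0 n)) t0 C.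
pose m s := fine (mem C s); pose kk s := memory_kernel T theta s t0.
have m0 s : 0 <= m s by apply: fine_ge0; exact: memory_ge0.
have kk0 s : 0 <= kk s by exact: memory_kernel_ge0.
have memE s : mem C s = (m s)%:E by rewrite fineK //; exact: memory_fin_num.
have mem_E n s : mem (C_ n) s = ((1 - l n) * m s + k * l n * kk s)%:E.
  by rewrite memory_add_mass //= memE.
have YE n s : s \in `[0, T] ->
    Y (C_ n) s = eta s + ((1 - l n) * m s + k * l n * kk s).
  by move=> sT; rewrite (satisfactionE eta theta _ sT) mem_E.
have YCE s : s \in `[0, T] -> Y C s = eta s + m s.
  by move=> sT; rewrite (satisfactionE eta theta _ sT).
have [B YB] := satisfaction_bounded T0 eta_continuous theta_ge0 theta_continuous C.
have [Th [Th0 kkTh]] := memory_kernel_bounded.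
have kTh : 0 <= k * Th by rewrite mulr_ge0.
have YB' s : s \in `[0, T] -> Y C s <= B + k * Th.
  by move=> sT; apply: le_trans (YB s sT) _; rewrite lerDl.
have YB_ n s : s \in `[0, T] -> Y (C_ n) s <= B + k * Th.
  move=> sT; rewrite YE // addrA; apply: lerD.
    apply: le_trans (YB s sT); rewrite YCE // lerD2l -[leRHS]mul1r ler_wpM2r //.
    by have := l0 n; lra.
  apply: ler_pM => //; last exact: kkTh.
  by rewrite -[leRHS]mulr1 ler_wpM2l //; have := l1 n; lra.
have cvgY s : s \in `[0, T] -> Y (C_ n) s @[n --> \oo] --> Y C s.
  move=> sT; rewrite (_ : (fun n => _) = fun n => Y C s + l n * (k * kk s - m s)).
    exact: cvg_segment.
  by apply/funext => n; rewrite YE // YCE //; ring.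
(* The factor 2 works because at least half of C is kept. *)
have mY_ n s : s \in `[0, T] -> m s <= 2 * Y (C_ n) s.
  move=> sT; rewrite YE //; have e0 := eta_ge0 sT.
  have kn : 0 <= k * l n * kk s by rewrite mulr_ge0.
  have : m s * (1 - l n) >= m s * 2^-1.
    by rewrite ler_wpM2l //; have := l1 n; lra.
  lra.
have p0 D s : s \in `[0, T] -> 0 <= p_ D s.
  by move=> sT; apply: ltW; exact: marginal_utility_gt0.
have mp D : measurable_fun `[0, T] (p_ D) by exact: measurable_marginal_utility.
have mm : measurable_fun `[0, T] m by exact: measurable_fine_memory.
have mkk : measurable_fun `[0, T] kk.
  apply: measurable_funTS.
  exact: (measurable_fun_pair1 t0 (measurable_memory_kernel T0 theta_continuous)).
pose X n := \int[mu]_(s in `[0, T]) (p_ (C_ n) s * m s).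
have [W pW] := marginal_utility_bounded T0 eta_ge0 eta_continuous theta_ge0
  theta_continuous fT (B + k * Th).
have pmW n s : s \in `[0, T] -> `|p_ (C_ n) s * m s| <= 2 * W.
  move=> sT; rewrite ger0_norm; last exact: mulr_ge0 (p0 _ _ sT) (m0 s).
  apply: le_trans (ler_wpM2l (p0 _ _ sT) (mY_ n s sT)) _.
  by rewrite mulrCA ler_wpM2l //; exact: (pW (C_ n) (YB_ n) s sT).
have cvgp s : s \in `[0, T] -> p_ (C_ n) s @[n --> \oo] --> p_ C s.
  exact: (@marginal_utility_cvg C_ C _ YB_ YB' cvgY).
have cvgX : X n @[n --> \oo] --> \int[mu]_(s in `[0, T]) (p_ C s * m s).
  apply: (bounded_convergence (m := mu) mT (lebesgue_itvcc_lty 0 T) _ pmW).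
    by move=> n; exact: (measurable_funM (mp (C_ n)) mm).
  by move=> s sT; apply: cvgMr_tmp; exact: cvgp.
have mass_le n : (\int[mu]_(s in `[0%R, T]) (k * (p_ (C_ n) s * kk s))%:E
    <= (X n)%:E)%E.
  set Z := (\int[mu]_(s in _) _)%E.
  have var := utility_variation T0 eta_ge0 eta_continuous theta_ge0
    theta_continuous fT (C_ n) C.
  have intX := marginal_memory_integrable T0 eta_ge0 eta_continuous theta_ge0
    theta_continuous fT (mY_ n).
  have eX : (\int[mu]_(s in `[0%R, T]) ((p_ (C_ n) s)%:E * mem C s) = (X n)%:E)%E.
    rewrite /X /Rintegral fineK; last exact: (integrable_fin_num (mu := mu) mT intX).
    by apply: eq_integral => s _; rewrite memE.
  have eX_ : (\int[mu]_(s in `[0%R, T]) ((p_ (C_ n) s)%:E * mem (C_ n) s) =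
      (1 - l n)%:E * (X n)%:E + (l n)%:E * Z)%E.
    have mpm : measurable_fun `[0, T] (fun s => (p_ (C_ n) s * m s)%:E).
      by apply/measurable_EFinP; exact: (measurable_funM (mp (C_ n)) mm).
    have mpk : measurable_fun `[0, T] (fun s => (k * (p_ (C_ n) s * kk s))%:E).
      apply/measurable_EFinP; apply: (measurable_funM (measurable_cst _)).
      exact: (measurable_funM (mp (C_ n)) mkk).
    have pm0 s : s \in `[0, T] -> (0 <= (p_ (C_ n) s * m s)%:E)%E.
      by move=> sT; rewrite lee_fin; exact: mulr_ge0 (p0 _ _ sT) (m0 s).
    have pk0 s : s \in `[0, T] -> (0 <= (k * (p_ (C_ n) s * kk s))%:E)%E.
      move=> sT; rewrite lee_fin; apply: mulr_ge0 => //.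
      exact: mulr_ge0 (p0 _ _ sT) (kk0 s).
    transitivity (\int[mu]_(s in `[0%R, T]) ((1 - l n)%:E * (p_ (C_ n) s * m s)%:E
        + (l n)%:E * (k * (p_ (C_ n) s * kk s))%:E))%E.
      apply: eq_integral => s _; rewrite mem_E -!EFinM -EFinD; congr EFin; ring.
    have ln0 : (0 <= (l n)%:E)%E by rewrite lee_fin ltW.
    have ln1 : (0 <= (1 - l n)%:E)%E by rewrite lee_fin.
    have := ge0_integralD mu mT (fun s sT => mule_ge0 ln1 (pm0 s sT))
      (emeasurable_funM (measurable_cst _) mpm)
      (fun s sT => mule_ge0 ln0 (pk0 s sT)) (emeasurable_funM (measurable_cst _) mpk).
    move=> ->; congr (_ + _)%E; last exact: (ge0_integralZl mu mT mpk pk0 ln0).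
    transitivity ((1 - l n)%:E * \int[mu]_(s in `[0%R, T]) (p_ (C_ n) s * m s)%:E)%E.
      exact: (ge0_integralZl mu mT mpm pm0 ln1).
    congr (_ * _)%E; apply: etrans eX.
    by apply: eq_integral => s _; rewrite memE.
  have V0 : 0 <= U C 0 - U (C_ n) 0.
    rewrite subr_ge0; apply: opt => /=; last by rewrite opprB addrC subrK.
    by rewrite gerBl ltW.
  have Z0 : (0 <= Z)%E.
    apply: integral_ge0 => s sT; rewrite lee_fin; apply: mulr_ge0 => //.
    exact: mulr_ge0 (p0 _ _ sT) (kk0 s).
  apply: (share_le (l0 n) V0 Z0).
  by move: var; rewrite [X in (_ + X <= _)%E]eX_ [leRHS]eX.
apply: (integral_lim_le (m := mu) (v := fun n => (X n)%:E)
  (f_ := fun n s => (k * (p_ (C_ n) s * kk s))%:E) mT).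
- move=> n; apply/measurable_EFinP; apply: (measurable_funM (measurable_cst _)).
  exact: (measurable_funM (mp (C_ n)) mkk).
- move=> n s sT; rewrite lee_fin; apply: mulr_ge0 => //.
  exact: mulr_ge0 (p0 _ _ sT) (kk0 s).
- move=> s sT; apply: cvg_EFin; first exact: nearW.
  by apply: cvgMl_tmp; apply: cvgMr_tmp; exact: cvgp.
- exact: mass_le.
- by apply: cvg_EFin => //; exact: nearW.
Qed.

End first_order.

(** * Positivity of the multiplier and the main theorem *)

Section positivity.
Context {R : realType}.
Notation mu := (@lebesgue_measure R).

Lemma integral_itvcc_gt0 (a b c d : R) (g : R -> R) : a < b ->
  c <= a -> b <= d -> measurable_fun `[c, d] g ->
  (forall x, x \in `[c, d] -> 0 <= g x) -> (forall x, x \in `[a, b] -> 0 < g x) ->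
  (0 < \int[mu]_(x in `[c, d]) (g x)%:E)%E.
Proof.
move=> ab ca bd mg g0 gpos.
have mcd : measurable (`[c, d]%classic : set R) by exact: measurable_itv.
have mab : measurable (`[a, b]%classic : set R) by exact: measurable_itv.
have mEg : measurable_fun `[c, d] (EFin \o g) by exact/measurable_EFinP.
rewrite lt_neqAle integral_ge0 ?andbT; last by move=> x xcd; rewrite lee_fin g0.
apply/eqP => g_eq0.
have /(ae_eq_integral_abs mu mcd mEg) aeg :
    (\int[mu]_(x in `[c, d]) `|(EFin \o g) x| = 0)%E.
  rewrite [RHS]g_eq0; apply: eq_integral => x; rewrite inE => xcd /=.
  by rewrite ger0_norm // g0.
have negl : mu.-negligible `[a, b].
  apply: negligibleS aeg => x xab /= /(_ (subitvcc ca bd xab)) => -[gx].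
  by have := gpos x xab; rewrite gx ltxx.
have mu_ab : mu `[a, b] = 0 by apply: measure_negligible; [exact: mab|exact: negl].
have : fine (mu `[a, b]) = 0 by rewrite mu_ab.
by rewrite lebesgue_itvcc ?ltW // => /eqP; rewrite subr_eq0 gt_eqF.
Qed.

(** By continuity [theta] is positive around the given point, but the times after
    [s] may form a null set when [s = T]; moving the mass to a slightly earlier time
    leaves an interval of times where the integrand is positive. *)
Lemma later_effect_gt0 (T : R) (theta : R -> R -> R) (p : R -> R) :
  0 < T ->
  (forall t s, t \in `[0, T] -> s \in `[0, T] -> 0 <= theta t s) ->
  {within `[0, T] `*` `[0, T], continuous (fun q : R * R => theta q.1 q.2)} ->
  (exists t s, [/\ 0 <= s, s <= t, t <= T & 0 < theta t s]) ->
  measurable_fun `[0, T] p -> (forall s, s \in `[0, T] -> 0 < p s) ->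
  exists2 t, t \in `[0, T] & (0 < later_effect T theta p t)%E.
Proof.
move=> T0 theta_ge0 theta_cont [t [s [s0 st tT theta_gt0]]] mp p_gt0.
have sI : s \in `[0, T] by rewrite in_itv /= s0 (le_trans st).
have tI : t \in `[0, T] by rewrite in_itv /= tT (le_trans s0).
have [d d0 dpos] : exists2 d, 0 < d & forall t' s', `|t - t'| < d -> `|s - s'| < d ->
    0 < theta (clamp T t') (clamp T s').
  have := @theta_clamp_continuous R T theta T0 theta_cont (t, s).
  move=> /cvgrPdist_lt /(_ (theta t s) theta_gt0) /nbhs_ballP[d /= d0 dP].
  exists d => // t' s' tt' ss'; have := dP (t', s') (conj tt' ss').
  by rewrite /= (clampE tI) (clampE sI) ltr_distl ltrDr => /andP[].
pose e := Num.min (d / 2) (T / 2).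
have e0 : 0 < e by rewrite lt_min !divr_gt0.
have ed : e < d by rewrite gt_min ltr_pdivrMr // ltr_pMr // ltr1n.
have eT : e <= T by rewrite ge_min; apply/orP; right; lra.
(* The mass is put at s, or a little before T when s is too close to T, so that
   an interval of later times remains in the neighbourhood of t. *)
pose s1 := Num.min s (T - e); pose a := Num.max s1 (t - e); pose b := Num.min T (t + e).
have s10 : 0 <= s1 by rewrite le_min s0 subr_ge0.
have s1T : s1 < T by rewrite gt_min; apply/orP; right; lra.
have s1s : s1 <= s by rewrite ge_min lexx.
have s1I : s1 \in `[0, T] by rewrite in_itv /= s10 ltW.
have ab : a < b by rewrite lt_min !gt_max s1T /=; apply/and3P; split; lra.
have s1a : s1 <= a by rewrite le_max lexx.
have bT : b <= T by rewrite ge_min lexx.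
exists s1 => //; apply: (integral_itvcc_gt0 ab s1a bT).
- apply: (eq_measurable_fun (fun r => p r * memory_kernel T theta r s1)).
    move=> r; rewrite inE => /itvP rs1; have /andP[s1r rT] : s1 <= r <= T by rewrite !rs1.
    rewrite memory_kernel_in // in_itv /= ?s10 //.
    by rewrite rT (le_trans s10).
  apply: measurable_funM; first exact: measurable_fun_subitv s10 (lexx T) mp.
  apply: measurable_funTS.
  exact: (measurable_fun_pair1 s1 (measurable_memory_kernel T0 theta_cont)).
- move=> r rs1; have rI := subitvcc s10 (lexx T) rs1.
  by rewrite mulr_ge0 ?theta_ge0 // ltW ?p_gt0.
- move=> r; rewrite in_itv /= => /andP[ar rb].
  have rI : r \in `[0, T].
    by rewrite in_itv /= (le_trans rb bT) (le_trans s10) ?(le_trans s1a).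
  rewrite mulr_gt0 ?p_gt0 //.
  have := dpos r s1; rewrite !clampE //; apply.
    move: ar rb; rewrite ge_max le_min => /andP[_ ar] /andP[_ rb].
    by rewrite ltr_distlC; apply/andP; split; lra.
  rewrite ger0_norm ?subr_ge0 // (le_lt_trans _ ed) // lerBlDr -lerBlDl.
  by rewrite le_min; apply/andP; split; [rewrite gerBl ltW|rewrite lerD2r (le_trans st)].
Qed.

End positivity.

Section multiplier.
Context {R : realType}.
Variables (T : R) (psi : R -> R) (C : cumulative R R) (G : R -> \bar R).
Notation LS := lebesgue_stieltjes_measure.
Hypothesis psi_gt0 : forall t, t \in `[0, T] -> 0 < psi t.
Hypothesis psi_continuous : {within `[0, T], continuous psi}.
Hypothesis mG : measurable_fun `[0, T] G.
Hypothesis G0 : forall t, t \in `[0, T] -> (0 <= G t)%E.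

Let mpsi : measurable_fun `[0, T] (fun t => (psi t)%:E).
Proof. by apply/measurable_EFinP; exact: subspace_continuous_measurable_fun. Qed.

Let psi0 t : t \in `[0, T] -> (0 <= (psi t)%:E)%E.
Proof. by move=> tT; rewrite lee_fin ltW // psi_gt0. Qed.

Let mT : measurable (`[0, T]%classic : set R).
Proof. exact: measurable_itv. Qed.

Lemma integral_price_scale M : 0 <= M ->
  (\int[LS C]_(t in `[0%R, T]) (M * psi t)%:E
   = M%:E * \int[LS C]_(t in `[0%R, T]) (psi t)%:E)%E.
Proof.
move=> M0; have ME : (0 <= M%:E)%E by rewrite lee_fin.
exact: (ge0_integralZl (LS C) mT mpsi psi0 ME).
Qed.

Lemma integral_le_price M : 0 <= M ->
  (forall t, t \in `[0, T] -> (G t <= (M * psi t)%:E)%E) ->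
  (\int[LS C]_(t in `[0%R, T]) G t
   <= M%:E * \int[LS C]_(t in `[0%R, T]) (psi t)%:E)%E.
Proof.
move=> M0 GM; rewrite -integral_price_scale //.
apply: ge0_le_integral; [exact: mT|exact: G0|exact: mG| |exact: GM].
apply/measurable_EFinP; apply: (measurable_funM (measurable_cst _)).
exact: subspace_continuous_measurable_fun.
Qed.

Lemma integral_sub_price M x L :
  (\int[LS C]_(t in `[0%R, T]) (psi t)%:E = x%:E)%E ->
  (\int[LS C]_(t in `[0%R, T]) G t = L%:E)%E -> 0 <= M ->
  (\int[LS C]_(t in `[0%R, T]) (G t - (M * psi t)%:E) = (L - M * x)%:E)%E.
Proof.
move=> psix GL M0.
have iG : (LS C).-integrable `[0, T] G.
  apply/integrableP; split; first exact: mG.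
  apply: (@le_lt_trans _ _ (\int[LS C]_(t in `[0%R, T]) G t)%E); last by rewrite GL ltry.
  rewrite le_eqVlt; apply/orP; left; apply/eqP; apply: eq_integral => t.
  by rewrite inE => tT; rewrite gee0_abs // G0.
have ipsi : (LS C).-integrable `[0, T] (fun t => (M * psi t)%:E).
  apply/integrableP; split.
    apply/measurable_EFinP; apply: (measurable_funM (measurable_cst _)).
    exact: subspace_continuous_measurable_fun.
  apply: (@le_lt_trans _ _ (\int[LS C]_(t in `[0%R, T]) (M * psi t)%:E)%E); last first.
    by rewrite integral_price_scale // psix -EFinM ltry.
  rewrite le_eqVlt; apply/orP; left; apply/eqP; apply: eq_integral => t.
  by rewrite inE => tT; rewrite gee0_abs // lee_fin mulr_ge0 // ltW // psi_gt0.
have e := integralB (mu := LS C) mT iG ipsi.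
by apply: etrans e _; rewrite GL integral_price_scale // psix -EFinM.
Qed.

End multiplier.

Lemma consumption_plan_add_mass {R : realType} (T t : R) (a b : {nonneg R})
    (C : cumulative R R) : t \in `[0, T] -> consumption_plan T C ->
  consumption_plan T (add_mass a b t C).
Proof.
rewrite in_itv /= => /andP[t0 tT] [C0 CT]; split=> x xT.
  by rewrite /= /add_mass C0 // leNgt (lt_le_trans xT t0) !mulr0 addr0.
by rewrite /= /add_mass CT // tT (le_trans tT xT).
Qed.

Theorem theorem3p2 (R : realType) (T w : R) (hT : 0 < T) (hw : 0 < w)
  (psi : R -> R)
  (psi_gt0 : forall t, t \in `[0, T] -> 0 < psi t)
  (psi_continuous : {within `[0, T], continuous psi})
  (eta : R -> R)
  (eta_ge0 : forall t, t \in `[0, T] -> 0 <= eta t)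
  (eta_continuous : {within `[0, T], continuous eta})
  (theta : R -> R -> R)
  (theta_ge0 : forall t s, t \in `[0, T] -> s \in `[0, T] -> 0 <= theta t s)
  (theta_continuous : {within `[0, T] `*` `[0, T],
     continuous (fun p : R * R => theta p.1 p.2)})
  (theta_nontrivial : exists t s, [/\ 0 <= s, s <= t, t <= T & 0 < theta t s])
  (f : R -> R -> R -> R)
  (f_assumptions : aggregator_assumptions T f)
  (C : cumulative R R) (hC : consumption_plan T C) :
  solves_utility_maximization T w psi eta theta f C <->
  exists M : R, [/\ 0 < M,
    (\int[lebesgue_stieltjes_measure C]_(t in `[0%R, T]) (psi t)%:E = w%:E)%E,
    (forall t, t \in `[0, T] ->
       (utility_gradient T f eta theta C t <= (M * psi t)%:E)%E) &
    (\int[lebesgue_stieltjes_measure C]_(t in `[0%R, T])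
       (utility_gradient T f eta theta C t - (M * psi t)%:E) = 0)%E].
Proof.
pose p := marginal_utility T eta theta f C.
pose G := later_effect T theta p.
have mT : measurable (`[0, T]%classic : set R) by exact: measurable_itv.
have mp : measurable_fun `[0, T] p by exact: measurable_marginal_utility.
have p_gt0 s : s \in `[0, T] -> 0 < p s by exact: marginal_utility_gt0.
have p_ge0 s : s \in `[0, T] -> 0 <= p s by move=> sT; rewrite ltW // p_gt0.
have mG : measurable_fun `[0, T] G by exact: measurable_later_effect.
have G0 t : t \in `[0, T] -> (0 <= G t)%E by exact: later_effect_ge0.
pose L := \int[lebesgue_measure]_(s in `[0, T]) (p s * fine (memory T theta C s)).
have GL : (\int[lebesgue_stieltjes_measure C]_(t in `[0%R, T]) G t = L%:E)%E.
  have intL := marginal_own_memory_integrable hT eta_ge0 eta_continuous theta_ge0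
    theta_continuous f_assumptions C.
  rewrite /L /Rintegral fineK; last first.
    exact: (integrable_fin_num (mu := lebesgue_measure) mT intL).
  apply: etrans; first exact: integral_later_effect.
  exact: integral_marginal_memory.
have psi_ge0 t : t \in `[0, T] -> 0 <= psi t by move=> tT; rewrite ltW // psi_gt0.
have mpsi : measurable_fun `[0, T] (fun t => (psi t)%:E).
  by apply/measurable_EFinP; exact: subspace_continuous_measurable_fun.
have psiE0 t : t \in `[0, T] -> (0 <= (psi t)%:E)%E.
  by move=> tT; rewrite lee_fin psi_ge0.
change (utility_gradient T f eta theta C) with G.
split=> [[[_ Cw] opt]|[M [M0 Cw GM GMC]]].
  have foc t : t \in `[0, T] -> (G t <= (L / w * psi t)%:E)%E.
    move=> tT; have psit := psi_gt0 t tT.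
    have k0 : 0 < w / psi t by rewrite divr_gt0.
    have feasible (a b : {nonneg R}) : a%:num <= 1 -> b%:num = w / psi t * (1 - a%:num) ->
        recursive_utility T f eta theta (add_mass a b t C) 0
        <= recursive_utility T f eta theta C 0.
      move=> a1 bE; apply: opt; split; first exact: consumption_plan_add_mass.
      rewrite (ge0_integral_add_mass a b C mT mpsi psiE0 tT).
      rewrite (_ : w%:E = a%:num%:E * w%:E + (b%:num)%:E * (psi t)%:E)%E; last first.
        by rewrite -!EFinM -EFinD bE; congr EFin; field; rewrite gt_eqF.
      by apply: leeD => //; apply: lee_wpmul2l.
    have first := first_order_condition hT eta_ge0 eta_continuous theta_ge0
      theta_continuous f_assumptions tT (ltW k0) feasible.
    have mpk : measurable_fun `[0, T] (fun s => (p s * memory_kernel T theta s t)%:E).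
      apply/measurable_EFinP; apply: (measurable_funM mp); apply: measurable_funTS.
      exact: (measurable_fun_pair1 t (measurable_memory_kernel hT theta_continuous)).
    have pk0 s : s \in `[0, T] -> (0 <= (p s * memory_kernel T theta s t)%:E)%E.
      move=> sT; rewrite lee_fin; apply: mulr_ge0 (p_ge0 s sT) _.
      exact: memory_kernel_ge0.
    have kE : (0 <= (w / psi t)%:E)%E by rewrite lee_fin ltW.
    have e := ge0_integralZl (@lebesgue_measure R) mT mpk pk0 kE.
    have kG : ((w / psi t)%:E * G t <= L%:E)%E.
      rewrite /G later_effectE //; apply: le_trans first.
      by rewrite le_eqVlt; apply/orP; left; apply/eqP; exact: esym e.
    move: (G0 t tT) kG; case: (G t) => [g _||] //=; last first.
      by rewrite gt0_muley ?lte_fin.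
    rewrite -EFinM !lee_fin => kg.
    rewrite (_ : L / w * psi t = (w / psi t)^-1 * L); last first.
      by field; rewrite !gt_eqF.
    by rewrite ler_pdivlMl.
  have L0 : 0 < L.
    have [t tT Gt] := later_effect_gt0 hT theta_ge0 theta_continuous
      theta_nontrivial mp p_gt0.
    have := lt_le_trans Gt (foc t tT).
    by rewrite lte_fin pmulr_lgt0 ?psi_gt0 // pmulr_lgt0 ?invr_gt0.
  have M0 : 0 < L / w by rewrite divr_gt0.
  have [x xE] : exists x : R,
      (\int[lebesgue_stieltjes_measure C]_(t in `[0%R, T]) (psi t)%:E = x%:E)%E.
    exists (fine (\int[lebesgue_stieltjes_measure C]_(t in `[0%R, T]) (psi t)%:E)%E).
    rewrite fineK // ge0_fin_numE; first exact: le_lt_trans Cw (ltry _).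
    by apply: integral_ge0 => t tT; rewrite lee_fin psi_ge0.
  (* Integrating (ii) against C gives L <= L / w * x. *)
  have xw : x = w.
    rewrite xE lee_fin in Cw; apply/le_anti; rewrite Cw /=.
    have := integral_le_price C psi_gt0 psi_continuous mG G0 (ltW M0) foc.
    rewrite GL xE -EFinM lee_fin mulrAC ler_pdivlMr // ler_pM2l //.
  exists (L / w); split => //; first by rewrite xE xw.
  rewrite (integral_sub_price psi_gt0 psi_continuous mG G0 xE GL (ltW M0)) xw.
  by rewrite divfK ?gt_eqF // subrr.
split; first by split; rewrite // Cw.
move=> D [hD Dw].
(* This is (iii), the integral of psi being w. *)
have LMw : L = M * w.
  have := integral_sub_price psi_gt0 psi_continuous mG G0 Cw GL (ltW M0).
  by rewrite GMC => /eqP; rewrite eqe eq_sym subr_eq0 => /eqP.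
have var := utility_variation hT eta_ge0 eta_continuous theta_ge0
  theta_continuous f_assumptions C D.
have GD : (\int[lebesgue_stieltjes_measure D]_(t in `[0%R, T]) G t <= (M * w)%:E)%E.
  apply: le_trans (integral_le_price D psi_gt0 psi_continuous mG G0 (ltW M0) GM) _.
  by rewrite EFinM lee_pmul2l ?lte_fin.
have pair X : (\int[lebesgue_measure]_(s in `[0%R, T]) ((p s)%:E * memory T theta X s) =
    \int[lebesgue_stieltjes_measure X]_(t in `[0%R, T]) G t)%E.
  by apply/esym; exact: integral_later_effect.
move: var; rewrite [X in (_ + X <= _)%E](pair C) [leRHS](pair D) GL.
move=> /le_trans /(_ GD); rewrite -EFinD lee_fin LMw.
by rewrite gerDr subr_le0.
Qed.
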